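(* Let $f:\mathbb{R}^k\to\mathbb{R}^k$ be a $C^r$ diffeomorphism ($r\ge1$) with hyperbolic fixed points $p_1,p_2$, let $W^u(p_1)$ have dimension $u_1$ and $W^s(p_2)$ have dimension $s_2$, with $m=u_1+s_2>k$, and let $P_1:B_{u_1}\to\mathbb{R}^k$, $P_2:B_{s_2}\to\mathbb{R}^k$ be $C^r$ chart maps parameterizing local pieces of $W^u(p_1)$ and $W^s(p_2)$ respectively. For some $l_1,l_2\in\mathbb{N}$ let $$F:B_{u_1}\times B_{s_2}\to\mathbb{R}^k,\qquad F(\theta,\phi)=f^{l_1}(P_1(\theta))-f^{-l_2}(P_2(\phi)).$$ Let $p^*\in B_{u_1}\times B_{s_2}$ with $F(p^* )=0$, let $A_1$ be an $m\times(m-k)$ matrix, $A_2$ an $m\times k$ matrix, $X=\prod_{i=1}^{m-k}[a_i,b_i]$, $Y=\prod_{i=1}^k[c_i,d_i]$, $\mathrm{x}_0\in X$, $\mathrm{y}_0\in Y$, with $p^*+A_1X+A_2Y\subset B_{u_1}\times B_{s_2}$. Assume that every matrix in $[DF_{X,Y}A_2]$ is invertible and that $$\mathrm{y}_0-[DF_{X,Y}A_2]^{-1}\bigl(F(p^*+A_1\mathrm{x}_0+A_2\mathrm{y}_0)+[DF_{X,\mathrm{y}_0}A_1][X-\mathrm{x}_0]\bigr)\subset Y,$$ where $DF_{X,Y}=DF(p^*+A_1X+A_2Y)$ and $DF_{X,\mathrm{y}_0}=DF(p^*+A_1X+A_2\mathrm{y}_0)$. Let $q:X\to Y$ be the function satisfying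 $F(p^*+A_1\mathrm{x}+A_2q(\mathrm{x}))=0$ for all $\mathrm{x}\in X$ (which exists under these assumptions), and define $$(\theta(\mathrm{x}),\phi(\mathrm{x}))=p^*+A_1\mathrm{x}+A_2q(\mathrm{x}),\qquad p(\mathrm{x})=f^{l_1}(P_1(\theta(\mathrm{x}))),\qquad \mathrm{x}\in X.$$ Then the manifolds $W^u(p_1)$ and $W^s(p_2)$ intersect transversally along $p(\mathrm{x})$ for $\mathrm{x}\in X$. Moreover, $p(\mathrm{x})$ is as smooth as $f$.
   Context: A fixed point is hyperbolic if the derivative of $f$ there has no eigenvalue on the unit circle. $W^s(p)=\{w:\lim_{n\to\infty}f^n(w)=p\}$, $W^u(p)=\{w:\lim_{n\to\infty}f^{-n}(w)=p\}$. $B_n$ is the unit ball centered at zero in $\mathbb{R}^n$; $\theta$ and $\phi$ are coordinates on $\mathbb{R}^{u_1}$ and $\mathbb{R}^{s_2}$. Chart maps are one-to-one immersions, so that their derivatives' images (transported by $Df^{l_1}$, $Df^{-l_2}$) are the tangent spaces of $W^u(p_1)$, $W^s(p_2)$. Transversal intersection at a point $w$ means $T_wW^u(p_1)+T_wW^s(p_2)=\mathbb{R}^k$. Interval notation. For $U\subset\mathbb{R}^k$, $[U]$ denotes an interval enclosure of $U$: a product of closed intervals containing $U$. For a family $\mathbf{A}$ of matrices, $[\mathbf{A}]$ denotes an interval enclosure: a set of all matrices whose $(i,j)$ entry lies in a given closed interval for each $i,j$, containing $\mathbf{A}$. $[\mathbf{A}][U]$ denotes an interval enclosure of $\{Au: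 A\in[\mathbf{A}],u\in[U]\}$, and if every matrix in $[\mathbf{A}]$ is invertible, $[\mathbf{A}]^{-1}[U]$ denotes an interval enclosure of $\{A^{-1}u:A\in[\mathbf{A}],u\in[U]\}$. Sums and differences of points and sets are elementwise. For a set $U$, $DF(U)$ denotes the family of derivatives $DF(u)$, $u\in U$; $DF_{X,Y}A_2$ denotes the family of products $MA_2$ with $M\in DF_{X,Y}$, and similarly for $DF_{X,\mathrm{y}_0}A_1$. *)

(* Defs.v *)
From HB Require Import structures.
From mathcomp Require Import all_boot all_order all_algebra.
From mathcomp Require Import all_classical all_reals all_analysis.
From mathcomp Require Export complex.

Set Implicit Arguments.
Unset Strict Implicit.
Unset Printing Implicit Defensive.

Import Order.TTheory GRing.Theory Num.Theory.
Import numFieldNormedType.Exports.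

Local Open Scope classical_set_scope.
Local Open Scope ring_scope.

(* C^n on an open set U.  In finite dimension, x |-> 'd f x is C^n iff
   x |-> 'd f x v is C^n for every fixed v. *)
Fixpoint Cn (R : realType) (V W : normedModType R) (n : nat) (U : set V)
    (f : V -> W) : Prop :=
  match n with
  | 0 => forall x, U x -> {for x, continuous f}
  | n'.+1 => (forall x, U x -> differentiable f x) /\
             (forall v, Cn n' U (fun x => 'd f x v))
  end.

(* r = None is the smoothness class C^oo. *)
Definition Cr (R : realType) (V W : normedModType R) (r : option nat)
    (U : set V) (f : V -> W) : Prop :=
  if r is Some n then Cn n U f else forall n, Cn n U f.

(* C^r on an arbitrary set S (a closed box, possibly with empty interior):
   f|_S has a C^r extension to a neighbourhood of each point of S. *)
Definition Cr_within (R : realType) (V W : normedModType R) (r : option nat)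
    (S : set V) (f : V -> W) : Prop :=
  forall x, S x -> exists (U : set V) (h : V -> W),
    [/\ open U, U x, Cr r U h & forall y, S y -> U y -> h y = f y].

Definition is_diffeo (R : realType) (k : nat) (r : option nat)
    (f finv : 'cV[R]_k -> 'cV[R]_k) : Prop :=
  [/\ cancel f finv, cancel finv f, Cr r setT f & Cr r setT finv].

(* Jacobian matrix acting on column vectors; the library's 'J acts on rows. *)
Definition jac (R : realType) (m n : nat) (f : 'cV[R]_n -> 'cV[R]_m)
    (x : 'cV[R]_n) : 'M[R]_(m, n) :=
  \matrix_(i, j) ('d f x (delta_mx j 0) : 'cV[R]_m) i 0.

Definition hyperbolic_fixpoint (R : realType) (k : nat)
    (f : 'cV[R]_k -> 'cV[R]_k) (p : 'cV[R]_k) : Prop :=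
  f p = p /\
  forall z : R[i],
    eigenvalue (map_mx (real_complex R) (jac f p)) z -> `|z| != 1.

(* Open and Euclidean; the library's ball is that of the max norm. *)
Definition unit_ball (R : realType) (n : nat) : set 'cV[R]_n :=
  [set x | \sum_(i < n) x i 0 ^+ 2 < 1].
Arguments unit_ball {R} n _.

(* W^s(p) for the map h.  With finv the inverse of f, W^u(p) for f is
   [stable_set finv p], so the notions below serve for both. *)
Definition stable_set (R : realType) (k : nat) (h : 'cV[R]_k -> 'cV[R]_k)
    (p : 'cV[R]_k) : set 'cV[R]_k :=
  [set w | iter n h w @[n --> \oo] --> p].

(* W^s(p) is in general only an immersed submanifold, and may accumulate on
   itself.  Its manifold topology (not the subspace one) is the topology of
   uniform closeness of forward orbits: points of W^s(p) whose whole orbits stay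
   close to that of w are exactly those mapped by a fixed iterate of h close to
   the image of w inside the embedded local stable manifold of p.
   [leaf_nbhs h p w] is the neighbourhood filter of w in that topology. *)
Definition leaf_nbhs (R : realType) (k : nat) (h : 'cV[R]_k -> 'cV[R]_k)
    (p w : 'cV[R]_k) : set_system 'cV[R]_k :=
  [set V | exists2 e : R, 0 < e & forall w', stable_set h p w' ->
     (forall n, `|iter n h w' - iter n h w| < e) -> V w'].

(* P : B_n -> W^s(p) is a one-to-one C^r immersion and, by the last clause, a
   homeomorphism onto an open piece of W^s(p) for the manifold topology. *)
Definition is_chart (R : realType) (k : nat) (r : option nat)
    (h : 'cV[R]_k -> 'cV[R]_k) (p : 'cV[R]_k) (n : nat)
    (P : 'cV[R]_n -> 'cV[R]_k) : Prop :=
  [/\ Cr r (unit_ball n) P,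
      forall x y, unit_ball n x -> unit_ball n y -> P x = P y -> x = y,
      forall x, unit_ball n x -> injective ('d P x),
      forall x, unit_ball n x -> stable_set h p (P x) &
      forall x, unit_ball n x ->
        forall V : set 'cV[R]_k,
          leaf_nbhs h p (P x) V <-> nbhs x (P @^-1` V)].

Definition stable_set_dim (R : realType) (k : nat) (r : option nat)
    (h : 'cV[R]_k -> 'cV[R]_k) (p : 'cV[R]_k) (n : nat) : Prop :=
  forall w, stable_set h p w ->
    exists P : 'cV[R]_n -> 'cV[R]_k,
      is_chart r h p P /\ exists2 x, unit_ball n x & P x = w.

(* T_w W^s(p): velocities at w of curves in W^s(p) that are continuous at 0 for
   its manifold topology. *)
Definition tangent_space (R : realType) (k : nat) (h : 'cV[R]_k -> 'cV[R]_k)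
    (p w : 'cV[R]_k) : set 'cV[R]_k :=
  [set v | exists gam : R -> 'cV[R]_k,
     [/\ gam 0 = w,
         (forall V, leaf_nbhs h p w V -> \forall t \near (0 : R), V (gam t)) &
         is_derive (0 : R) (1 : R) gam v]].

Definition transversal_at (R : realType) (k : nat)
    (f finv : 'cV[R]_k -> 'cV[R]_k) (p1 p2 w : 'cV[R]_k) : Prop :=
  [/\ stable_set finv p1 w, stable_set f p2 w &
      [set v1 + v2 | v1 in tangent_space finv p1 w
                   & v2 in tangent_space f p2 w] = setT].

(* The interval matrix [lo, hi]; for one column, a product of intervals. *)
Definition imx (R : realType) (m n : nat) (lo hi : 'M[R]_(m, n)) :
    set 'M[R]_(m, n) :=
  [set A | forall i j, lo i j <= A i j <= hi i j].

(* F(theta, phi) = f^l1 (P1 theta) - f^-l2 (P2 phi), a point of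
   R^u x R^s being the column vector with theta on top of phi. *)
Definition Fmap (R : realType) (k u s : nat)
    (f finv : 'cV[R]_k -> 'cV[R]_k) (P1 : 'cV[R]_u -> 'cV[R]_k)
    (P2 : 'cV[R]_s -> 'cV[R]_k) (l1 l2 : nat) (z : 'cV[R]_(u + s)) :
    'cV[R]_k :=
  iter l1 f (P1 (usubmx z)) - iter l2 finv (P2 (dsubmx z)).

Definition ball_prod (R : realType) (u s : nat) : set 'cV[R]_(u + s) :=
  [set z | unit_ball u (usubmx z) /\ unit_ball s (dsubmx z)].
Arguments ball_prod {R} u s _.

(* p + A1 X + A2 Y *)
Definition affine_image (R : realType) (m d k : nat) (p : 'cV[R]_m)
    (A1 : 'M[R]_(m, d)) (A2 : 'M[R]_(m, k)) (X : set 'cV[R]_d)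
    (Y : set 'cV[R]_k) : set 'cV[R]_m :=
  [set p + A1 *m x + A2 *m y | x in X & y in Y].

(* The property defining q : X -> Y; values of q outside X are irrelevant. *)
Definition zero_graph (R : realType) (m d k : nat)
    (F : 'cV[R]_m -> 'cV[R]_k) (p : 'cV[R]_m)
    (A1 : 'M[R]_(m, d)) (A2 : 'M[R]_(m, k)) (X : set 'cV[R]_d)
    (Y : set 'cV[R]_k) (q : 'cV[R]_d -> 'cV[R]_k) : Prop :=
  forall x, X x -> Y (q x) /\ F (p + A1 *m x + A2 *m q x) = 0.

(* Main.v *)
(* For x in X, the mean value theorem bounds F(p* + A1 x + A2 y0) by the
   enclosure in the hypothesis, so the interval Newton operator of
   y |-> F(p* + A1 x + A2 y) maps y0 into Y.  If A, M range over an interval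
   matrix all of whose members are invertible, A^-1 M is a P-matrix; a
   one-variable-at-a-time elimination then solves the complementarity problem of
   this map on the box Y, and the Newton inclusion forces the solution to be a
   zero.  It is unique since differences of values are M (y - y') with M
   invertible.  The same existence result on small boxes around (x, q(x)) gives
   the implicit function extending q, whose derivative is
   - (DF A2)^-1 DF A1; induction on the order of smoothness shows that it is C^r.
   Finally DF is onto at each zero because DF A2 is invertible, and
   DF (w1, w2) = D(f^l1 P1) w1 - D(f^-l2 P2) w2 exhibits every vector as a sum
   of tangent vectors to the two manifolds. *)
Require Import Defs.
From HB Require Import structures.
From mathcomp Require Import all_boot all_order all_algebra.
From mathcomp Require Import all_classical all_reals all_analysis.
From mathcomp Require Import ring lra.
Import Order.TTheory GRing.Theory Num.Theory.
Import numFieldNormedType.Exports.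
Local Open Scope classical_set_scope.
Local Open Scope ring_scope.
Set Implicit Arguments.
Unset Strict Implicit.
Unset Printing Implicit Defensive.

(** * Regular interval matrices and complementarity on a box *)

(* A^-1 M is a P-matrix.  With u = A^-1 M v, the sign condition lets each
   difference A_j u_j - M_j v_j of columns be written as E_j (u_j - v_j) with
   E_j between A_j and M_j, so that E (u - v) = 0 with E invertible. *)
Lemma unitmx_interval_pmatrix (R : realType) (k : nat)
    (lo hi A M : 'M[R]_k) (v : 'cV[R]_k) :
  (forall E, imx lo hi E -> E \in unitmx) -> imx lo hi A -> imx lo hi M ->
  (forall i, v i 0 * (invmx A *m (M *m v)) i 0 <= 0) -> v = 0.
Proof.
move=> unit_imx boxA boxM; set u := invmx A *m (M *m v) => uv_le0.
have AuMv : A *m u = M *m v by rewrite mulKVmx // unit_imx.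
clearbody u.
(* The weights satisfy [t j * (u j 0 - v j 0) = u j 0] and [(1 - t j) * (u j 0 - v j 0) = - v j 0],
   which is what column [j] of [E] needs. If [u j 0 = v j 0], both are zero and division by zero
   makes [t j] zero. *)
pose t j := u j 0 / (u j 0 - v j 0).
pose E : 'M[R]_k := \matrix_(i, j) (A i j * t j + M i j * (1 - t j)).
have uvE j : u j 0 = v j 0 -> u j 0 = 0 /\ v j 0 = 0.
  by move=> e; have := uv_le0 j; rewrite e => ?; split; nra.
have t01 j : 0 <= t j <= 1.
  rewrite /t; have [e|ne] := eqVneq (u j 0) (v j 0).
    by rewrite e subrr invr0 mulr0 lexx ler01.
  have := uv_le0 j; move: ne; rewrite -subr_eq0.
  move: (u j 0) (v j 0) => x y nz xy.
  (* Over a square denominator the bounds become [0 <= x * (x - y) <= (x - y) ^+ 2], and both follow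
     from [x * y <= 0]. *)
  have -> : x / (x - y) = (x * (x - y)) * (x - y)^-1 ^+ 2 by field.
  rewrite mulr_ge0 ?sqr_ge0//=; last by nra.
  rewrite exprVn ler_pdivrMr ?exprn_even_gt0//; nra.
have EE : E *m (u - v) = 0.
  transitivity (A *m u - M *m v); last by rewrite AuMv subrr.
  apply/colP => i; rewrite !mxE -sumrB; apply: eq_bigr => j _; rewrite !mxE.
  rewrite /t; have [/uvE[-> ->]|ne] := eqVneq (u j 0) (v j 0).
    by rewrite !subrr !mulr0 subrr.
  by rewrite -subr_eq0 in ne; field.
have boxE : imx lo hi E.
  move=> i j; rewrite mxE; have := boxA i j; have := boxM i j; have := t01 j.
  by move: (A i j) (M i j) (lo i j) (hi i j) (t j); clear; intros; nra.
have /subr0_eq uv : u - v = 0.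
  by rewrite -(mulKmx (unit_imx _ boxE) (u - v)) EE mulmx0.
by apply/colP => i; have := uv_le0 i; rewrite uv mxE; nra.
Qed.

(** Separates the first coordinate from the others, for the induction on the dimension. *)
Definition cons_cv (R : realType) (k : nat) (t : R) (y : 'cV[R]_k) :
    'cV[R]_k.+1 :=
  \col_i oapp (fun j => y j 0) t (unlift ord0 i).

Lemma cons_cv0 (R : realType) (k : nat) (t : R) (y : 'cV[R]_k) :
  cons_cv t y ord0 0 = t.
Proof. by rewrite mxE unlift_none. Qed.

Lemma cons_cv_lift (R : realType) (k : nat) (t : R) (y : 'cV[R]_k) j :
  cons_cv t y (lift ord0 j) 0 = y j 0.
Proof. by rewrite mxE liftK. Qed.

Lemma cvg_mx (R : realType) (T : Type) (F : set_system T) (m n : nat)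
    (f : T -> 'M[R]_(m, n)) (M : 'M[R]_(m, n)) : Filter F ->
  (forall i j, f x i j @[x --> F] --> M i j) -> f @ F --> M.
Proof.
move=> FF fM; apply/cvgrPdist_le => e e0; near=> x.
rewrite /Num.Def.normr/= mx_normrE (bigmax_le _ (ltW e0))//= => -[i j] _ /=.
rewrite !mxE; move: (i) (j); near: x.
apply: filter_forall => a; apply: filter_forall => b.
exact: ((cvgrPdist_le _ _).1 (fM a b)).
Unshelve. all: by end_near. Qed.

Lemma continuous_mx (R : realType) (T : topologicalType) (m n : nat)
    (f : T -> 'M[R]_(m, n)) (x : T) :
  (forall i j, {for x, continuous (fun z => f z i j)}) -> {for x, continuous f}.
Proof. by move=> fx; exact: cvg_mx. Qed.

Lemma continuous_entry (R : realType) (T : topologicalType) (m n : nat)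
    (f : T -> 'M[R]_(m, n)) (x : T) i j :
  {for x, continuous f} -> {for x, continuous (fun z => f z i j)}.
Proof.
by move=> fx; exact: cvg_comp fx (@coord_continuous _ _ _ i j (f x)).
Qed.

Lemma continuous_cons_cv (R : realType) (k : nat) (T : topologicalType)
    (t : T -> R) (y : T -> 'cV[R]_k) x :
  {for x, continuous t} -> {for x, continuous y} ->
  {for x, continuous (fun z => cons_cv (t z) (y z))}.
Proof.
move=> ct cy; apply: continuous_mx => i j; rewrite (ord1 j) {j}.
case: (unliftP ord0 i) => [j|] ->; last first.
  by rewrite (_ : (fun z => _) = t)//; apply/funext => z; rewrite cons_cv0.
rewrite (_ : (fun z => _) = fun z => y z j 0); last first.
  by apply/funext => z; rewrite cons_cv_lift.
exact: continuous_entry.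
Qed.

(** For [c <= d] this is a retraction onto the box; composing with it makes a map that is continuous
    on the box continuous everywhere. *)
Definition clamp_cv (R : realType) (k : nat) (c d y : 'cV[R]_k) : 'cV[R]_k :=
  \col_i Num.max (c i 0) (Num.min (y i 0) (d i 0)).

Lemma continuous_clamp_cv (R : realType) (k : nat) (c d : 'cV[R]_k) :
  continuous (clamp_cv c d).
Proof.
move=> y; apply: continuous_mx => i j; rewrite (ord1 j) {j}.
rewrite (_ : (fun z => _) = fun z : 'cV[R]_k =>
    Num.max (c i 0) (Num.min (z i 0) (d i 0))); last first.
  by apply/funext => z; rewrite mxE.
have cy : {for y, continuous (fun z : 'cV[R]_k => Num.min (z i 0) (d i 0))}.
  by apply: continuous_min; [exact: coord_continuous|exact: cst_continuous].
by apply: (continuous_max _ cy); exact: cst_continuous.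
Qed.

Lemma clamp_cv_box (R : realType) (k : nat) (c d y : 'cV[R]_k) :
  (forall i, c i 0 <= d i 0) -> imx c d (clamp_cv c d y).
Proof.
move=> cd i j; rewrite (ord1 j) mxE le_max lexx ge_max cd/=.
by rewrite ge_min lexx orbT.
Qed.

Lemma clamp_cv_id (R : realType) (k : nat) (c d y : 'cV[R]_k) :
  imx c d y -> clamp_cv c d y = y.
Proof.
move=> Yy; apply/colP => i; rewrite mxE; have /andP[cy yd] := Yy i 0.
by rewrite (min_idPl yd) (max_idPr cy).
Qed.
(** The endpoint [c] works if [g c >= 0], and [d] works if [g d <= 0]; otherwise [g] changes sign
    and the intermediate value theorem gives a zero. *)
Lemma interval_complementarity (R : realType) (c d : R) (g : R -> R) :
  c <= d -> continuous g ->
  exists t, c <= t <= d /\ forall s, c <= s <= d -> (t - s) * g t <= 0.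
Proof.
move=> cd cg; have [gc|gc] := leP 0 (g c).
  exists c; split; first by rewrite lexx.
  by move=> s /andP[cs _]; nra.
have [gd|gd] := leP (g d) 0.
  exists d; split; first by rewrite lexx cd.
  by move=> s /andP[_ sd]; nra.
have [||t tcd gt] := @IVT R g c d 0 cd.
- exact: continuous_subspaceT.
- by rewrite ge_min le_max (ltW gc) (ltW gd) orbT.
exists t; rewrite gt; split=> [|s _]; last by rewrite mulr0.
by rewrite -[_ && _]/(t \in `[c, d]).
Qed.

(** If [phi y0 + e] lies in the interval, strict monotonicity makes [g y0] positive there, and this
    persists for [y] near [y0]. A value [phi y] at or above that point would then violate the
    inequality tested against [phi y0]. The lower bound is symmetric, and beyond an endpoint there
    is nothing to prove. *)
Lemma continuous_interval_complementarity (R : realType) (T : topologicalType)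
    (c d : R) (g : T -> R -> R) (phi : T -> R) :
  (forall s y, c <= s <= d -> {for y, continuous (g^~ s)}) ->
  (forall y, c <= phi y <= d /\
    forall s, c <= s <= d -> (phi y - s) * g y (phi y) <= 0) ->
  (forall y s t, c <= s <= d -> c <= t <= d -> s < t -> g y s < g y t) ->
  continuous phi.
Proof.
move=> cg phiP g_mono y0; have [phi0I phi0P] := phiP y0.
apply/cvgrPdist_lt => e e0.
have up : \forall y \near y0, phi y < phi y0 + e.
  have [dlt|le_d] := ltP d (phi y0 + e).
    by near=> y; have [/andP[_ /le_lt_trans->]] := phiP y.
  have sI : c <= phi y0 + e <= d.
    by rewrite le_d andbT; case/andP: phi0I => ? ?; lra.
  have gs0 : 0 < g y0 (phi y0 + e).
    apply: le_lt_trans (g_mono y0 _ _ phi0I sI _); last by lra.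
    by have := phi0P _ sI; nra.
  have gs := @cvgr_gt _ _ _ _ (g^~ _) _ (cg _ y0 sI) _ gs0.
  near=> y; have gys : 0 < g y (phi y0 + e) by near: y; exact: gs.
  have [phiI phiyP] := phiP y.
  rewrite ltNge; apply/negP => le_phi.
  have : g y (phi y0 + e) <= g y (phi y).
    move: le_phi; rewrite le_eqVlt => /predU1P[->//|lt].
    exact/ltW/g_mono.
  by have := phiyP _ phi0I; nra.
have lo : \forall y \near y0, phi y0 - e < phi y.
  have [dlt|le_d] := ltP (phi y0 - e) c.
    by near=> y; have [/andP[/(lt_le_trans dlt)]] := phiP y.
  have sI : c <= phi y0 - e <= d.
    by rewrite le_d /=; case/andP: phi0I => ? ?; lra.
  have gs0 : g y0 (phi y0 - e) < 0.
    apply: lt_le_trans (g_mono y0 _ _ sI phi0I _) _; first by lra.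
    by have := phi0P _ sI; nra.
  have gs := @cvgr_lt _ _ _ _ (g^~ _) _ (cg _ y0 sI) _ gs0.
  near=> y; have gys : g y (phi y0 - e) < 0 by near: y; exact: gs.
  have [phiI phiyP] := phiP y.
  rewrite ltNge; apply/negP => le_phi.
  have : g y (phi y) <= g y (phi y0 - e).
    move: le_phi; rewrite le_eqVlt => /predU1P[->//|lt].
    exact/ltW/g_mono.
  by have := phiyP _ phi0I; nra.
near=> y; rewrite ltr_distlC; apply/andP; split; first by near: y.
by near: y.
Unshelve. all: by end_near. Qed.

(* Replaces Brouwer's theorem: the first coordinate is eliminated by solving
   the one-dimensional problem, whose solution is unique by the P-property, and
   the P-property is inherited by the remaining coordinates. *)
Lemma box_complementarity (R : realType) (k : nat) (c d : 'cV[R]_k)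
    (G : 'cV[R]_k -> 'cV[R]_k) :
  (forall i, c i 0 <= d i 0) -> continuous G ->
  (forall y y', imx c d y -> imx c d y' ->
    (forall i, (y i 0 - y' i 0) * (G y i 0 - G y' i 0) <= 0) -> y = y') ->
  exists2 y, imx c d y &
    forall i t, c i 0 <= t <= d i 0 -> (y i 0 - t) * G y i 0 <= 0.
Proof.
elim: k => [|k IHk] in c d G *.
  by move=> _ _ _; exists c; case.
move=> cd cG PG.
pose c' : 'cV[R]_k := \col_j c (lift ord0 j) 0.
pose d' : 'cV[R]_k := \col_j d (lift ord0 j) 0.
have cd' i : c' i 0 <= d' i 0 by rewrite !mxE.
pose K := clamp_cv c' d'.
have KY y : imx c' d' (K y) by exact: clamp_cv_box.
have consY t y : c ord0 0 <= t <= d ord0 0 -> imx c d (cons_cv t (K y)).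
  move=> tcd i j; rewrite (ord1 j) {j}; case: (unliftP ord0 i) => [j|] ->.
    by rewrite cons_cv_lift; have := KY y j 0; rewrite /c' /d' !mxE.
  by rewrite cons_cv0.
pose g y t := G (cons_cv t (K y)) ord0 0.
have cK y : {for y, continuous K} by exact: continuous_clamp_cv.
have cGcons (T : topologicalType) (t : T -> R) (y : T -> 'cV[R]_k) i x :
    {for x, continuous t} -> {for x, continuous y} ->
    {for x, continuous (fun z => G (cons_cv (t z) (y z)) i 0)}.
  move=> ct cy; have cc := continuous_cons_cv ct cy.
  by apply: continuous_entry; apply: (@continuous_comp _ _ _ _ G _ cc (cG _)).
have ex_phi y : exists t, c ord0 0 <= t <= d ord0 0 /\
    forall s, c ord0 0 <= s <= d ord0 0 -> (t - s) * g y t <= 0.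
  apply: interval_complementarity => // t.
  by apply: (cGcons _ id (cst (K y))); [exact: cvg_id|exact: cst_continuous].
have [phi phiP] := choice ex_phi.
(* The P-property is applied to two points that differ in the first coordinate only. *)
have g_mono y s t : c ord0 0 <= s <= d ord0 0 -> c ord0 0 <= t <= d ord0 0 ->
    s < t -> g y s < g y t.
  move=> sI tI st; rewrite ltNge; apply/negP => gts.
  suff /matrixP/(_ ord0 0) : cons_cv s (K y) = cons_cv t (K y).
    by rewrite !cons_cv0 => e; rewrite e ltxx in st.
  apply: PG; [exact: consY|exact: consY|] => i.
  case: (unliftP ord0 i) => [j|] ->.
    by rewrite !cons_cv_lift subrr mul0r.
  by rewrite !cons_cv0 -/(g y s) -/(g y t); nra.
have cphi : continuous phi.
  apply: (continuous_interval_complementarity _ phiP g_mono) => s y _.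
  by apply: cGcons => //; exact: cst_continuous.
(* The reduced problem: the first coordinate is replaced by its solution, a continuous function of
   the others. *)
pose G' y : 'cV[R]_k := \col_j G (cons_cv (phi y) (K y)) (lift ord0 j) 0.
have [||y Yy soly] := IHk c' d' G' cd'.
- move=> y; apply: continuous_mx => i j.
  rewrite (ord1 j) {j} (_ : (fun z => _) =
    fun z => G (cons_cv (phi z) (K z)) (lift ord0 i) 0).
    by apply: cGcons => //; exact: cphi.
  by apply/funext => z; rewrite mxE.
- move=> y y' Yy Yy' yy'.
  have [phiI phiyP] := phiP y; have [phiI' phiyP'] := phiP y'.
  have Ky : K y = y by exact: clamp_cv_id.
  have Ky' : K y' = y' by exact: clamp_cv_id.
  have : cons_cv (phi y) (K y) = cons_cv (phi y') (K y').
    apply: PG; [exact: consY|exact: consY|] => i.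
    case: (unliftP ord0 i) => [j|] ->.
      have := yy' j; rewrite !cons_cv_lift Ky Ky'.
      by rewrite [in X in X -> _]mxE [in X in X -> _]mxE Ky Ky'.
    (* The product for the first coordinate is nonpositive: test each of the solutions [phi y] and
       [phi y'] against the other and add. *)
    rewrite !cons_cv0 -/(g y (phi y)) -/(g y' (phi y')).
    by have := phiyP _ phiI'; have := phiyP' _ phiI; nra.
  rewrite Ky Ky' => E; apply/colP => j.
  by rewrite -(cons_cv_lift (phi y)) E cons_cv_lift.
have [phiI phiyP] := phiP y.
exists (cons_cv (phi y) (K y)); first exact: consY.
move=> i t; case: (unliftP ord0 i) => [j|] ->.
  have := soly j t; rewrite cons_cv_lift [K y]clamp_cv_id // mxE [d' _ _]mxE.
  by rewrite [G' _ _ _]mxE [K y]clamp_cv_id.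
by rewrite cons_cv0; exact: phiyP.
Qed.
(** * Functions of class C^n *)

Definition pack_linear (R : pzRingType) (V W : lmodType R) (f : V -> W)
    (f_lin : linear f) : {linear V -> W} :=
  HB.pack f (GRing.isLinear.Build _ _ _ _ f f_lin).

Lemma differentiable_near (R : realType) (V W : normedModType R) (F : V -> W)
    (x : V) (e : R) :
  differentiable F x -> 0 < e ->
  \forall y \near x, `|F y - F x - 'd F x (y - x)| <= e * `|y - x|.
Proof.
move=> dF e0; have /diff_locallyP[_ /eqaddoP] := dF.
move=> /(_ e e0) H; rewrite (near_shift 0 x); move: H; apply: filterS => y /=.
by rewrite subr0 addrK !fctE /= opprD addrA.
Qed.

Lemma near_differentiable (R : realType) (V W : normedModType R) (F : V -> W)
    (x : V) (L : {linear V -> W}) : continuous L ->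
  (forall e : R, 0 < e ->
    \forall y \near x, `|F y - F x - L (y - x)| <= e * `|y - x|) ->
  differentiable F x /\ 'd F x = L :> (V -> W).
Proof.
move=> cL FL.
have FE : F \o shift x = cst (F x) + L +o_ 0 id.
  apply/eqaddoP => e e0; have := FL e e0; rewrite (near_shift 0 x).
  apply: filterS => y /=.
  by rewrite subr0 addrK !fctE /= opprD addrA.
have dE := diff_unique cL FE; split=> //.
by apply/diff_locallyP; rewrite dE.
Qed.

Lemma near_eq_diff (R : realType) (V W : normedModType R) (F G : V -> W)
    (x : V) :
  {near x, F =1 G} -> differentiable F x ->
  differentiable G x /\ 'd G x = 'd F x :> (V -> W).
Proof.
move=> FG dF; apply: near_differentiable; first exact: diff_continuous.
move=> e e0; have Gx := nbhs_singleton FG.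
near=> y; rewrite -Gx -(near FG y)//.
by near: y; exact: differentiable_near.
Unshelve. all: by end_near. Qed.

Section Cn_theory.
Context {R : realType} {V : normedModType R}.
Implicit Types (W : normedModType R) (U : set V).

Lemma open_eq_diff W U (F G : V -> W) x : open U -> U x ->
  (forall y, U y -> F y = G y) -> differentiable F x ->
  differentiable G x /\ 'd G x = 'd F x :> (V -> W).
Proof.
move=> oU Ux FG; apply: near_eq_diff.
by apply: filterS (open_nbhs_nbhs (conj oU Ux)).
Qed.

(** The rules below replace a differential by a formula valid only on [U]. Since [U] is open,
    equality on it passes to differentials, hence to every order. *)
Lemma Cn_eq W n U (F G : V -> W) : open U ->
  (forall y, U y -> F y = G y) -> Cn n U F -> Cn n U G.
Proof.
move=> oU; elim: n F G => [|n IHn] F G FG /=.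
  move=> cF x Ux; rewrite /prop_for/= /continuous_at -FG//.
  apply: cvg_trans (cF x Ux); apply: near_eq_cvg.
  by apply: filterS (open_nbhs_nbhs (conj oU Ux)).
move=> [dF CF]; split=> [x Ux|v].
  exact: (open_eq_diff oU Ux FG (dF x Ux)).1.
apply: (IHn (fun x => 'd F x v)) (CF v) => x Ux.
by rewrite (open_eq_diff oU Ux FG (dF x Ux)).2.
Qed.

Lemma Cn_sub W n U U' (F : V -> W) : U' `<=` U -> Cn n U F -> Cn n U' F.
Proof.
move=> sU; elim: n F => [|n IHn] F /=; first by move=> cF x /sU; exact: cF.
by move=> [dF CF]; split=> [x /sU|v]; [exact: dF|exact: IHn].
Qed.

Lemma CnW W n U (F : V -> W) : Cn n.+1 U F -> Cn n U F.
Proof.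
elim: n F => [|n IHn] F; first by case=> dF _ x /dF/differentiable_continuous.
by case=> dF CF; split=> // v; exact: IHn.
Qed.

Lemma Cn_le W m n U (F : V -> W) : (m <= n)%N -> Cn n U F -> Cn m U F.
Proof.
move=> /subnK <-; elim: (n - m)%N => [//|j IHj] CF.
by apply/IHj/CnW.
Qed.

Lemma Cn_cst W n U (w : W) : Cn n U (fun=> w).
Proof.
elim: n w => [|n IHn] w /=; first by move=> x _; exact: cst_continuous.
split=> [x _|v]; first exact: differentiable_cst.
rewrite (_ : (fun x => _) = fun=> 0)//; apply/funext => x.
by rewrite diff_cst.
Qed.

Lemma Cn_linear W n U (L : {linear V -> W}) : continuous L -> Cn n U L.
Proof.
move=> cL; case: n => [|n] /=; first by move=> x _; exact: cL.
split=> [x _|v]; first exact: linear_differentiable.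
rewrite (_ : (fun x => _) = fun=> L v); first exact: Cn_cst.
by apply/funext => x; rewrite diff_lin.
Qed.

Lemma Cn_linear_comp W W' n U (L : {linear W -> W'}) (F : V -> W) :
  open U -> continuous L -> Cn n U F -> Cn n U (L \o F).
Proof.
move=> oU cL; elim: n F => [|n IHn] F /=.
  by move=> cF x Ux; apply: continuous_comp (cF x Ux) (cL _).
move=> [dF CF]; have dL x := linear_differentiable x cL.
split=> [x /dF dFx|v]; first exact: differentiable_comp.
apply: (Cn_eq oU _ (IHn _ (CF v))) => x /dF dFx.
by rewrite diff_comp//= diff_lin.
Qed.

Lemma Cn_add W n U (F G : V -> W) : open U ->
  Cn n U F -> Cn n U G -> Cn n U (fun x => F x + G x).
Proof.
move=> oU; elim: n F G => [|n IHn] F G /=.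
  by move=> cF cG x Ux; apply: continuousD; [exact: cF|exact: cG].
move=> [dF CF] [dG CG]; split=> [x Ux|v].
  by apply: differentiableD; [exact: dF|exact: dG].
apply: (Cn_eq oU _ (IHn _ _ (CF v) (CG v))) => x Ux.
exact: esym (congr1 (fun h : V -> W => h v) (diffD (dF x Ux) (dG x Ux))).
Qed.

Lemma Cn_opp W n U (F : V -> W) : open U ->
  Cn n U F -> Cn n U (fun x => - F x).
Proof.
move=> oU; elim: n F => [|n IHn] F /=.
  by move=> cF x Ux; apply: continuousN; exact: cF.
move=> [dF CF]; split=> [x Ux|v]; first by apply: differentiableN; exact: dF.
apply: (Cn_eq oU _ (IHn _ (CF v))) => x Ux.
exact: esym (congr1 (fun h : V -> W => h v) (diffN (dF x Ux))).
Qed.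

Lemma Cn_sum W n U (I : Type) (r : seq I) (P : pred I) (F : I -> V -> W) :
  open U -> (forall i, P i -> Cn n U (F i)) ->
  Cn n U (fun x => \sum_(i <- r | P i) F i x).
Proof.
move=> oU CF; elim: r => [|i r IHr].
  by apply: (Cn_eq oU _ (Cn_cst n U 0)) => x _; rewrite big_nil.
case: (boolP (P i)) => Pi; last first.
  by apply: (Cn_eq oU _ IHr) => x _; rewrite big_cons (negbTE Pi).
by apply: (Cn_eq oU _ (Cn_add oU (CF i Pi) IHr)) => x _; rewrite big_cons Pi.
Qed.

Lemma Cn_mul n U (a b : V -> R) : open U ->
  Cn n U a -> Cn n U b -> Cn n U (fun x => a x * b x).
Proof.
move=> oU; elim: n a b => [|n IHn] a b.
  by move=> ca cb x Ux; apply: continuousM; [exact: ca|exact: cb].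
(* The product rule contains the factors themselves, which are therefore needed at order [n] as
   well. *)
move=> Ca Cb; have Ca' := CnW Ca; have Cb' := CnW Cb.
case: Ca Cb => [da Ca] [db Cb]; split=> [x Ux|v].
  by apply: differentiableM; [exact: da|exact: db].
have H := Cn_add oU (IHn _ _ Ca' (Cb v)) (IHn _ _ Cb' (Ca v)).
apply: (Cn_eq oU _ H) => x Ux.
exact: esym (congr1 (fun h : V -> R => h v) (diffM (da x Ux) (db x Ux))).
Qed.

Lemma Cn_prod n U (I : Type) (r : seq I) (P : pred I) (a : I -> V -> R) :
  open U -> (forall i, P i -> Cn n U (a i)) ->
  Cn n U (fun x => \prod_(i <- r | P i) a i x).
Proof.
move=> oU Ca; elim: r => [|i r IHr].
  by apply: (Cn_eq oU _ (Cn_cst n U (1 : R))) => x _; rewrite big_nil.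
case: (boolP (P i)) => Pi; last first.
  by apply: (Cn_eq oU _ IHr) => x _; rewrite big_cons (negbTE Pi).
by apply: (Cn_eq oU _ (Cn_mul oU (Ca i Pi) IHr)) => x _; rewrite big_cons Pi.
Qed.

(** The differential of the inverse is that of [a] times minus the squared inverse, and the inverse
    has order [n] by induction. *)
Lemma Cn_inv n U (a : V -> R) : open U -> (forall x, U x -> a x != 0) ->
  Cn n U a -> Cn n U (fun x => (a x)^-1).
Proof.
move=> oU a0; elim: n => [|n IHn].
  by move=> ca x Ux; apply: continuousV; [exact: a0|exact: ca].
move=> Ca; have Cia := IHn (CnW Ca); case: Ca => da Ca.
split=> [x Ux|v]; first by apply: differentiableV; [exact: da|exact: a0].
have H := Cn_mul oU (Cn_opp oU (Cn_mul oU Cia Cia)) (Ca v).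
apply: (Cn_eq oU _ H) => x Ux.
rewrite -invfM -expr2.
exact: esym (congr1 (fun h : V -> R => h v) (diffV (da x Ux) (a0 x Ux))).
Qed.

Lemma Cn_mx n U (p q : nat) (F : V -> 'M[R]_(p, q)) : open U ->
  (forall i j, Cn n U (fun x => F x i j)) -> Cn n U F.
Proof.
move=> oU CF.
have lin_delta i j : linear (fun a : R => a *: delta_mx i j : 'M[R]_(p, q)).
  by move=> a b c; rewrite scalerDl scalerA.
pose D i j := pack_linear (lin_delta i j).
have cD i j : continuous (D i j) by move=> a; exact: scalel_continuous.
have H := Cn_sum (index_enum _) oU (fun i (_ : xpredT i) =>
  Cn_sum (index_enum _) oU (fun j (_ : xpredT j) =>
    Cn_linear_comp oU (cD i j) (CF i j))).
by apply: (Cn_eq oU _ H) => x Ux; rewrite [RHS]matrix_sum_delta.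
Qed.

Lemma Cn_entry n U (p q : nat) (F : V -> 'M[R]_(p, q)) i j : open U ->
  Cn n U F -> Cn n U (fun x => F x i j).
Proof.
move=> oU; have lin_entry : linear (fun N : 'M[R]_(p, q) => N i j).
  by move=> a M N; rewrite !mxE.
exact: (@Cn_linear_comp _ _ _ _ (pack_linear lin_entry) F oU
  (@coord_continuous _ _ _ i j)).
Qed.

Lemma Cn_mulmx n U (p q r : nat) (A : V -> 'M[R]_(p, q))
    (B : V -> 'M[R]_(q, r)) : open U -> Cn n U A -> Cn n U B ->
  Cn n U (fun x => A x *m B x).
Proof.
move=> oU CA CB; apply: Cn_mx => // i j.
have H := Cn_sum (index_enum _) oU (fun l (_ : xpredT l) =>
  Cn_mul oU (Cn_entry i l oU CA) (Cn_entry l j oU CB)).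
by apply: (Cn_eq oU _ H) => x Ux; rewrite mxE.
Qed.

Lemma Cn_det n U (p : nat) (A : V -> 'M[R]_p) : open U ->
  Cn n U A -> Cn n U (fun x => \det (A x)).
Proof.
move=> oU CA; apply: Cn_sum => // s _; apply: Cn_mul => //; first exact: Cn_cst.
by apply: Cn_prod => // i _; exact: Cn_entry.
Qed.

(** By Cramer's rule each entry of the inverse is a cofactor divided by the determinant. *)
Lemma Cn_invmx n U (p : nat) (A : V -> 'M[R]_p) : open U ->
  (forall x, U x -> A x \in unitmx) -> Cn n U A ->
  Cn n U (fun x => invmx (A x)).
Proof.
move=> oU uA CA; apply: Cn_mx => // i j.
have Cdet : Cn n U (fun x => (\det (A x))^-1).
  apply: Cn_inv => // [x /uA|]; first by rewrite unitmxE unitfE.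
  exact: Cn_det.
have Ccof : Cn n U (fun x => cofactor (A x) j i).
  apply: Cn_mul => //; first exact: Cn_cst.
  apply: Cn_det => //; apply: Cn_mx => // a b.
  have H := Cn_entry (lift j a) (lift i b) oU CA.
  by apply: (Cn_eq oU _ H) => x Ux; rewrite !mxE.
apply: (Cn_eq oU _ (Cn_mul oU Cdet Ccof)) => x Ux.
by rewrite /invmx uA // !mxE.
Qed.

End Cn_theory.

Lemma linear_cV_expand (R : realType) (W : normedModType R) (m : nat)
    (L : {linear 'cV[R]_m -> W}) (v : 'cV[R]_m) :
  L v = \sum_j v j 0 *: L (delta_mx j 0).
Proof.
rewrite [in LHS](matrix_sum_delta v) linear_sum; apply: eq_bigr => j _.
by rewrite big_ord1 linearZ.
Qed.

(** [Cn] speaks of differentials in a fixed direction, whereas the chain rule evaluates that of [G]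
    in the direction ['d F x v], which varies with [x]. Expanding this direction in the standard
    basis gives a sum of products of scalar functions, to which the induction hypothesis and
    [Cn_mul] apply. *)
Lemma Cn_comp_scalar (R : realType) (V : normedModType R) (m n : nat)
    (U : set V) (U' : set 'cV[R]_m) (F : V -> 'cV[R]_m) (G : 'cV[R]_m -> R) :
  open U -> open U' -> (forall x, U x -> U' (F x)) ->
  Cn n U F -> Cn n U' G -> Cn n U (G \o F).
Proof.
move=> oU oU' FU; elim: n G => [|n IHn] G.
  by move=> cF cG x Ux; apply: continuous_comp (cF x Ux) (cG _ (FU x Ux)).
move=> CF; have CF' := CnW CF; case: CF => dF CF [dG CG].
split=> [x Ux|v].
  by apply: differentiable_comp; [exact: dF|exact/dG/FU].
have H := Cn_sum (index_enum _) oU (fun j (_ : xpredT j) =>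
  Cn_mul oU (Cn_entry j 0 oU (CF v)) (IHn _ CF' (CG (delta_mx j 0)))).
apply: (Cn_eq oU _ H) => x Ux.
rewrite (diff_comp (dF x Ux) (dG _ (FU x Ux)))/=.
by rewrite [RHS]linear_cV_expand.
Qed.

Lemma Cn_comp (R : realType) (V : normedModType R) (m p q n : nat)
    (U : set V) (U' : set 'cV[R]_m) (F : V -> 'cV[R]_m)
    (G : 'cV[R]_m -> 'M[R]_(p, q)) :
  open U -> open U' -> (forall x, U x -> U' (F x)) ->
  Cn n U F -> Cn n U' G -> Cn n U (G \o F).
Proof.
move=> oU oU' FU CF CG; apply: Cn_mx => // i j.
exact: (Cn_comp_scalar oU oU' FU CF (Cn_entry i j oU' CG)).
Qed.
(** * The interval Newton method *)

Lemma mx_entry_le_norm (R : realType) (m n : nat) (M : 'M[R]_(m, n)) i j :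
  `|M i j| <= `|M|.
Proof.
rewrite [leRHS]/Num.Def.normr/= mx_normrE.
exact: (le_bigmax _ (fun ij : 'I_m * 'I_n => `|M ij.1 ij.2|) (i, j)).
Qed.

Lemma mx_norm_le (R : realType) (m n : nat) (M : 'M[R]_(m, n)) (e : R) :
  0 <= e -> (forall i j, `|M i j| <= e) -> `|M| <= e.
Proof.
by move=> e0 Me; rewrite [leLHS]/Num.Def.normr/= mx_normrE bigmax_le.
Qed.

Lemma mx_norm_mulmx (R : realType) (m n p : nat) (A : 'M[R]_(m, n))
    (B : 'M[R]_(n, p)) : `|A *m B| <= n%:R * `|A| * `|B|.
Proof.
apply: mx_norm_le => [|i j]; first by rewrite !mulr_ge0.
rewrite mxE (le_trans (ler_norm_sum _ _ _))// -mulrA mulr_natl.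
have -> : `|A| * `|B| *+ n = \sum_(l < n) `|A| * `|B|.
  by rewrite sumr_const card_ord.
apply: ler_sum => l _.
by rewrite normrM ler_pM// mx_entry_le_norm.
Qed.

Lemma continuous_mulmxl (R : realType) (m n p : nat) (A : 'M[R]_(m, n)) :
  continuous (mulmx A : 'M[R]_(n, p) -> 'M[R]_(m, p)).
Proof.
(* [Cn 0] is continuity at each point of the set, so the calculus of [Cn] also yields continuity
   statements. *)
move=> B; have : Cn 0 setT (fun B : 'M[R]_(n, p) => A *m B).
  apply: Cn_mulmx; [exact: openT|exact: Cn_cst|].
  exact: (@Cn_linear _ _ _ 0 setT idfun (fun x => @cvg_id _ _)).
exact.
Qed.

Lemma jac_mulmx (R : realType) (m n : nat) (F : 'cV[R]_n -> 'cV[R]_m)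
    (x v : 'cV[R]_n) : jac F x *m v = 'd F x v.
Proof.
rewrite [RHS]linear_cV_expand; apply/colP => i; rewrite mxE summxE.
by apply: eq_bigr => j _; rewrite !mxE mulrC.
Qed.

Lemma Cn_jac (R : realType) (m n p : nat) (U : set 'cV[R]_n)
    (F : 'cV[R]_n -> 'cV[R]_m) : open U -> Cn p.+1 U F -> Cn p U (jac F).
Proof.
move=> oU [_ CF]; apply: Cn_mx => // i j.
have H := Cn_entry i 0 oU (CF (delta_mx j 0)).
by apply: (Cn_eq oU _ H) => x _; rewrite mxE.
Qed.

Lemma is_derive_line (R : realType) (V W : normedModType R) (F : V -> W)
    (z w : V) (t : R) : differentiable F (z + t *: w) ->
  is_derive t 1 (fun s => F (z + s *: w)) ('d F (z + t *: w) w).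
Proof.
move=> dF; pose l : R -> V := cst z + ( *:%R^~ w).
have dl : is_diff t l (0 + ( *:%R^~ w)) by exact: is_diffD.
have [dFl dFlE] :=
  is_diff_comp dl (differentiableP (dF : differentiable F (l t))).
split; first exact: (@diff_derivable _ _ _ (F \o l) t 1 dFl).
transitivity ('D_1 (F \o l) t); first by [].
rewrite (deriveE (1 : R) dFl) dFlE /=.
by rewrite !fctE add0r scale1r.
Qed.

Lemma diff_entry (R : realType) (V : normedModType R) (m n : nat)
    (F : V -> 'M[R]_(m, n)) (x v : V) i j : differentiable F x ->
  differentiable (fun y => F y i j) x /\
  'd (fun y => F y i j) x v = ('d F x v) i j.
Proof.
move=> dF; have lin_entry : linear (fun N : 'M[R]_(m, n) => N i j).
  by move=> a M N; rewrite !mxE.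
have cL : continuous (pack_linear lin_entry).
  exact: (@coord_continuous _ _ _ i j).
have dL := linear_differentiable (F x) cL.
split; first exact: (differentiable_comp dF dL).
exact: etrans (congr1 (fun h : V -> R => h v) (diff_comp dF dL))
  (congr1 (fun h : 'M[R]_(m, n) -> R => h ('d F x v)) (diff_lin (F x) cL)).
Qed.

(* The intermediate point depends on the row, so that M is in general not a
   derivative of F but belongs to any interval matrix enclosing them. *)
Lemma interval_mean_value (R : realType) (m n p : nat)
    (F : 'cV[R]_m -> 'cV[R]_n) (B : 'M[R]_(m, p)) (z : 'cV[R]_m)
    (v : 'cV[R]_p) (lo hi : 'M[R]_(n, p)) :
  (forall t : R, 0 <= t <= 1 -> differentiable F (z + t *: (B *m v)) /\
     imx lo hi (jac F (z + t *: (B *m v)) *m B)) ->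
  exists2 M, imx lo hi M & F (z + B *m v) - F z = M *m v.
Proof.
move=> FB.
have row_mvt i : exists t : R, 0 <= t <= 1 /\
    F (z + B *m v) i 0 - F z i 0 = (jac F (z + t *: (B *m v)) *m B *m v) i 0.
  pose g s := F (z + s *: (B *m v)) i 0.
  have dg (t : R) : 0 <= t <= 1 ->
      is_derive t 1 g ((jac F (z + t *: (B *m v)) *m B *m v) i 0).
    move=> /FB[dF _]; have [dFi dFiE] := diff_entry (B *m v) i 0 dF.
    rewrite -mulmxA jac_mulmx -dFiE.
    exact: is_derive_line.
  have [||t t01 gt] := @MVT_segment R g
    (fun t => (jac F (z + t *: (B *m v)) *m B *m v) i 0) 0 1 ler01.
  - move=> t; rewrite in_itv/= => /andP[t0 t1]; apply: dg.
    by rewrite !ltW.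
  - by apply: derivable_within_continuous => t; rewrite in_itv/= => /dg [].
  exists t; split; first by rewrite in_itv/= in t01.
  by move: gt; rewrite /g scale1r scale0r addr0 subr0 mulr1.
have [t tP] := choice row_mvt.
exists (\matrix_(i, j) (jac F (z + t i *: (B *m v)) *m B) i j).
  by move=> i j; rewrite mxE; exact: (FB _ (tP i).1).2.
apply/colP => i; transitivity ((jac F (z + t i *: (B *m v)) *m B *m v) i 0).
  by rewrite -(tP i).2 !mxE.
by rewrite [LHS]mxE [RHS]mxE; apply: eq_bigr => j _; rewrite [in RHS]mxE.
Qed.

(** A product of segments is compact in the space of row vectors, and [vec_mx] carries it
    continuously onto the interval matrix. *)
Lemma imx_compact (R : realType) (m n : nat) (lo hi : 'M[R]_(m, n)) :
  compact (imx lo hi).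
Proof.
pose B := [set v : 'rV[R]_(m * n) | forall i,
  `[mxvec lo 0 i, mxvec hi 0 i]%classic (v 0 i)].
have cB : compact B.
  apply: (@rV_compact _ _ (fun i => `[mxvec lo 0 i, mxvec hi 0 i]%classic)).
  by move=> i; exact: segment_compact.
have -> : imx lo hi = vec_mx @` B.
  apply/seteqP; split=> [M boxM|_ [v Bv <-] i j].
    exists (mxvec M); last exact: mxvecK.
    move=> l; case/mxvec_indexP: l => i j.
    by rewrite !mxvecE /= in_itv/=; exact: boxM.
  have := Bv (mxvec_index i j); rewrite /= in_itv/= !mxvecE.
  by rewrite mxE.
apply: continuous_compact cB; apply: continuous_subspaceT => v.
apply: continuous_mx => i j.
rewrite (_ : (fun z => _) = fun v : 'rV[R]_(m * n) => v 0 (mxvec_index i j)).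
  exact: coord_continuous.
by apply/funext => w; rewrite mxE.
Qed.

Lemma open_unitmx (R : realType) (k : nat) :
  open [set A : 'M[R]_k | A \in unitmx].
Proof.
have cdet : continuous (fun A : 'M[R]_k => \det A).
  move=> A; have : Cn 0 setT (fun A : 'M[R]_k => \det A).
    apply: Cn_det; first exact: openT.
    exact: (@Cn_linear _ _ _ 0 setT idfun (fun x => @cvg_id _ _)).
  exact.
rewrite (_ : [set A | _] = (fun A : 'M[R]_k => \det A) @^-1` [set x | x != 0]).
  by apply: open_comp => [A _|]; [exact: cdet|exact: open_neq].
by apply/seteqP; split=> A; rewrite /= unitmxE unitfE.
Qed.

(** Inversion is continuous on a compact set of invertible matrices, hence bounded there. *)
Lemma unitmx_interval_expansive (R : realType) (k : nat) (lo hi : 'M[R]_k) :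
  (forall A, imx lo hi A -> A \in unitmx) ->
  exists2 C : R, 0 < C &
    forall A (v : 'cV[R]_k), imx lo hi A -> `|v| <= C * `|A *m v|.
Proof.
move=> uA.
have cinv : {within imx lo hi, continuous (@invmx R k)}.
  apply: continuous_in_subspaceT => A /set_mem /uA unitA.
  have : Cn 0 [set A : 'M[R]_k | A \in unitmx] (fun A => invmx A).
    apply: Cn_invmx; [exact: open_unitmx|by []|].
    exact: (@Cn_linear _ _ _ 0 _ idfun (fun x => @cvg_id _ _)).
  exact.
have [M [_ /(_ (`|M| + 1))]] :=
  compact_bounded (continuous_compact cinv (@imx_compact _ _ _ lo hi)).
rewrite (le_lt_trans (ler_norm M)) ?ltrDl// => /(_ isT) bd.
(* The factor [k] comes from the max norm of a matrix product; the last [1] keeps the constant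
   positive when [k = 0]. *)
exists (k%:R * (`|M| + 1) + 1); first by rewrite ltr_wpDl// mulr_ge0.
move=> A v boxA; rewrite -[leLHS](congr1 _ (mulKmx (uA A boxA) v)).
apply: le_trans (mx_norm_mulmx _ _) _.
have bA : `|invmx A| <= `|M| + 1 by apply: bd; exists A.
by rewrite ler_wpM2r// ler_wpDr// ler_wpM2l.
Qed.

(* Solve the complementarity problem for y |-> A0^-1 g(y) on the box.  With
   z = y0 - M^-1 g(y0) in the box and g(y) - g(y0) = M (y - y0), the solution y
   satisfies A0^-1 g(y) = A0^-1 M (y - z), and testing it against z shows that
   y = z, that is, g(y) = 0. *)
Lemma interval_newton (R : realType) (k : nat) (c d y0 : 'cV[R]_k)
    (g : 'cV[R]_k -> 'cV[R]_k) (lo hi : 'M[R]_k) :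
  imx c d y0 -> (forall A, imx lo hi A -> A \in unitmx) ->
  (forall y, imx c d y -> {for y, continuous g}) ->
  (forall y y', imx c d y -> imx c d y' ->
    exists2 M, imx lo hi M & g y - g y' = M *m (y - y')) ->
  (forall M, imx lo hi M -> imx c d (y0 - invmx M *m g y0)) ->
  exists2 y, imx c d y & g y = 0.
Proof.
(* The mean value hypothesis at the pair [y0], [y0] shows that the interval matrix is nonempty; any
   member can serve as preconditioner. *)
move=> Yy0 uA cg gM newtonY; have [A0 boxA0 _] := gM _ _ Yy0 Yy0.
have cd i : c i 0 <= d i 0 by have /andP[/le_trans] := Yy0 i 0; apply.
pose G y := invmx A0 *m g (clamp_cv c d y).
have cG : continuous G.
  move=> y; apply: (@continuous_comp _ _ _ (fun y => g (clamp_cv c d y))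
    (mulmx (invmx A0))); last exact: continuous_mulmxl.
  apply: (@continuous_comp _ _ _ (clamp_cv c d) g).
    exact: continuous_clamp_cv.
  exact/cg/clamp_cv_box.
have GE y : imx c d y -> G y = invmx A0 *m g y.
  by move=> Yy; rewrite /G clamp_cv_id.
have [|y Yy soly] := @box_complementarity R k c d G cd cG.
  move=> y y' Yy Yy' yy'; apply/subr0_eq.
  have [M boxM gyy'] := gM _ _ Yy Yy'.
  apply: (unitmx_interval_pmatrix uA boxA0 boxM) => i.
  rewrite -gyy' mulmxBr -!GE// mxE [(- y') _ _]mxE.
  by have := yy' i; rewrite !mxE.
have [M boxM gy] := gM _ _ Yy Yy0.
exists y => //; pose z := y0 - invmx M *m g y0.
have gyz : g y = M *m (y - z).
  by rewrite /z opprB addrCA mulmxDr mulKVmx ?uA// -gy addrC subrK.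
suff yz : y - z = 0 by rewrite gyz yz mulmx0.
apply: (unitmx_interval_pmatrix uA boxA0 boxM) => i.
rewrite -gyz -GE//; have := soly i (z i 0) (newtonY _ boxM i 0).
by rewrite !mxE.
Qed.
(** Closed balls of the max norm are boxes, so the interval lemmas apply to small neighbourhoods. *)
Lemma imx_ball (R : realType) (m n : nat) (M0 M : 'M[R]_(m, n)) (e : R) :
  0 <= e ->
  imx (M0 - const_mx e) (M0 + const_mx e) M <-> `|M - M0| <= e.
Proof.
move=> e0; split=> [boxM|Me i j].
  apply: mx_norm_le => // i j; have := boxM i j; rewrite !mxE => /andP[? ?].
  by rewrite ler_norml; apply/andP; split; lra.
have := le_trans (mx_entry_le_norm (M - M0) i j) Me.
by rewrite !mxE ler_norml => /andP[? ?]; apply/andP; split; lra.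
Qed.

Lemma imx_convex (R : realType) (m n : nat) (lo hi M N : 'M[R]_(m, n))
    (t : R) : 0 <= t <= 1 -> imx lo hi M -> imx lo hi N ->
  imx lo hi (N + t *: (M - N)).
Proof.
move=> t01 boxM boxN i j; have := boxM i j; have := boxN i j; rewrite !mxE.
by move: t01 => /andP[? ?] /andP[? ?] /andP[? ?]; apply/andP; split; nra.
Qed.

Lemma near_norm (R : realType) (V : normedModType R) (x : V) (P : V -> Prop) :
  (\forall y \near x, P y) ->
  exists2 e : R, 0 < e & forall y, `|y - x| < e -> P y.
Proof.
move=> /nbhs_ballP[e /= e0 eP]; exists e => // y yx; apply: eP.
by rewrite -ball_normE /= distrC.
Qed.

(** * Implicit functions *)

Section affine_zero.
Context {R : realType} {m d k : nat} (F : 'cV[R]_m -> 'cV[R]_k)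
  (D : set 'cV[R]_m) (p : 'cV[R]_m) (A1 : 'M[R]_(m, d)) (A2 : 'M[R]_(m, k)).
Implicit Types (h q : 'cV[R]_d -> 'cV[R]_k) (x : 'cV[R]_d) (y : 'cV[R]_k).

Local Notation z x y := (p + A1 *m x + A2 *m y).

Lemma continuous_affine h x : {for x, continuous h} ->
  {for x, continuous (fun x' => z x' (h x'))}.
Proof.
move=> ch; apply: (@continuousD _ _ _ (fun x' => p + A1 *m x')).
  apply: (@continuousD _ _ _ (fun _ => p)); first exact: cst_continuous.
  exact: continuous_mulmxl.
exact: (@continuous_comp _ _ _ h (mulmx A2) _ ch
  (@continuous_mulmxl _ _ _ _ _ _)).
Qed.

Lemma affineB x x' y y' : z x y - z x' y' = A1 *m (x - x') + A2 *m (y - y').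
Proof.
rewrite !mulmxBr opprD addrACA; congr (_ + _).
by rewrite opprD addrACA subrr add0r.
Qed.

(** Linearizing [F] between two zeros and applying [invmx B] bounds [dh - N *m dx] by a small
    multiple of the norms of [dx] and [dh]. Since [dh] is in turn bounded by [dh - N *m dx] and
    [dx], its contribution is absorbed on the left. *)
Lemma zero_differentiable h x0 :
  {for x0, continuous h} -> differentiable F (z x0 (h x0)) ->
  jac F (z x0 (h x0)) *m A2 \in unitmx ->
  (\forall x \near x0, F (z x (h x)) = 0) ->
  differentiable h x0 /\ forall v, 'd h x0 v =
    - (invmx (jac F (z x0 (h x0)) *m A2) *m (jac F (z x0 (h x0)) *m (A1 *m v))).
Proof.
move=> ch dF uB F0; set z0 := z x0 (h x0) in dF uB *.
set B := jac F z0 *m A2 in uB *.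
pose N := - (invmx B *m (jac F z0 *m A1)).
have [||dh dhE] := @near_differentiable R _ _ h x0 (mulmx N).
- exact: continuous_mulmxl.
- move=> e e0.
  pose a := d%:R * `|A1|; pose b := k%:R * `|A2|.
  pose l := d%:R * `|N|; pose K := k%:R * `|invmx B|.
  have a0 : 0 <= a by rewrite mulr_ge0.
  have b0 : 0 <= b by rewrite mulr_ge0.
  have l0 : 0 <= l by rewrite mulr_ge0.
  have K0 : 0 <= K by rewrite mulr_ge0.
  have bl0 : 0 <= b * l by rewrite mulr_ge0.
  have Kb0 : 0 <= K * b by rewrite mulr_ge0.
  have Kabl0 : 0 <= K * (a + b * l) by rewrite mulr_ge0// addr_ge0.
  (* The first bound lets half of the error be absorbed; the second makes the remaining term at most
     half of [e] times the norm of [dx]. The summands [1] avoid zero denominators. *)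
  pose eta := Num.min (1 / (2 * (K * b + 1))) (e / (2 * (K * (a + b * l) + 1))).
  have eta0 : 0 < eta by rewrite lt_min !divr_gt0// mulr_gt0// ltr_wpDl.
  have eta1 : K * b * eta <= 1 / 2.
    have : eta <= 1 / (2 * (K * b + 1)) by rewrite ge_min lexx.
    by rewrite ler_pdivlMr ?mulr_gt0 ?ltr_wpDl//; nra.
  have eta2 : 2 * (K * (a + b * l)) * eta <= e.
    have : eta <= e / (2 * (K * (a + b * l) + 1)) by rewrite ge_min lexx orbT.
    by rewrite ler_pdivlMr ?mulr_gt0 ?ltr_wpDl//; nra.
  have cz := continuous_affine ch.
  have Fz := cz _ (differentiable_near dF eta0).
  near=> x.
  have Fx0 : F z0 = 0 by exact: (nbhs_singleton F0).
  have Fx : F (z x (h x)) = 0 by near: x.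
  have : `|F (z x (h x)) - F z0 - 'd F z0 (z x (h x) - z0)|
    <= eta * `|z x (h x) - z0| by near: x.
  rewrite Fx Fx0 subr0 sub0r normrN -jac_mulmx affineB.
  move: (x - x0) (h x - h x0) => dx dh small.
  have dhE : dh - N *m dx =
      invmx B *m (jac F z0 *m (A1 *m dx + A2 *m dh)).
    rewrite !mulmxDr [jac F z0 *m (A2 *m dh)]mulmxA -/B mulKmx//.
    by rewrite /N mulNmx opprK addrC !mulmxA.
  change (`|dh - N *m dx| <= e * `|dx|).
  have h1 : `|dh - N *m dx| <= K * (eta * (a * `|dx| + b * `|dh|)).
    rewrite dhE (le_trans (mx_norm_mulmx _ _))// ler_wpM2l//.
    rewrite (le_trans small)// (ler_wpM2l (ltW eta0))//.
    by rewrite (le_trans (ler_normD _ _))// lerD// mx_norm_mulmx.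
  have h2 : `|dh| <= `|dh - N *m dx| + l * `|dx|.
    rewrite -[X in `|X| <= _](subrK (N *m dx)).
    by rewrite (le_trans (ler_normD _ _))// lerD// mx_norm_mulmx.
  have : 0 <= `|dx| by [].
  have : 0 <= `|dh - N *m dx| by [].
  move: `|dh - N *m dx| `|dx| `|dh| h1 h2 => E X H h1 h2 E0 X0.
  have h3 : E <= K * b * eta * E + K * (a + b * l) * eta * X.
    apply: le_trans h1 _.
    have : K * eta * b * H <= K * eta * b * (E + l * X).
      by rewrite ler_wpM2l// !mulr_ge0// ltW.
    by lra.
  have h4 : K * b * eta * E <= 1 / 2 * E by rewrite ler_wpM2r.
  have h5 : 2 * (K * (a + b * l)) * eta * X <= e * X by rewrite ler_wpM2r.
  by lra.
split=> // v; rewrite dhE /= /N mulNmx.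
by rewrite !mulmxA.
Unshelve. all: by end_near. Qed.

Lemma Cn_affine n (U : set 'cV[R]_d) h : open U -> Cn n U h ->
  Cn n U (fun x => z x (h x)).
Proof.
move=> oU Ch; apply: Cn_add => //.
  apply: Cn_add => //; first exact: Cn_cst.
  by apply: Cn_linear; exact: continuous_mulmxl.
by apply: Cn_mulmx => //; exact: Cn_cst.
Qed.

(** Bootstrapping: the differential of [h] is a smooth expression in [jac F] along the graph of [h],
    so order [j] for [h] gives order [j.+1], as long as [jac F] has order [j]. *)
Lemma Cn_zero n (U : set 'cV[R]_d) h : open U -> open D ->
  Cn n.+1 D F -> (forall x, U x -> {for x, continuous h}) ->
  (forall x, U x -> [/\ D (z x (h x)), F (z x (h x)) = 0 &
     jac F (z x (h x)) *m A2 \in unitmx]) ->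
  Cn n.+1 U h.
Proof.
move=> oU oD CF ch zh.
have Dz x : U x -> D (z x (h x)) by move=> /zh[].
have Uz x : U x -> jac F (z x (h x)) *m A2 \in unitmx by move=> /zh[].
have dh x : U x -> differentiable h x /\ forall v, 'd h x v =
    - (invmx (jac F (z x (h x)) *m A2) *m (jac F (z x (h x)) *m (A1 *m v))).
  move=> Ux; apply: zero_differentiable; [exact: ch|exact/CF.1/Dz|exact: Uz|].
  have := open_nbhs_nbhs (conj oU Ux); apply: filterS => x' Ux'.
  by have [] := zh _ Ux'.
suff : forall j, (j <= n.+1)%N -> Cn j U h by apply.
elim=> [_|j IHj jn]; first exact: ch.
split=> [x /dh[]//|v].
have CJ : Cn j U (fun x => jac F (z x (h x))).
  apply: (Cn_comp oU oD Dz); first exact/Cn_affine/IHj/ltnW.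
  exact/(Cn_jac oD)/(Cn_le jn).
have H : Cn j U (fun x => - (invmx (jac F (z x (h x)) *m A2) *m
    (jac F (z x (h x)) *m (A1 *m v)))).
  apply: Cn_opp => //; apply: Cn_mulmx => //; last first.
    by apply: Cn_mulmx => //; exact: Cn_cst.
  by apply: Cn_invmx => //; apply: Cn_mulmx => //; exact: Cn_cst.
by apply: (Cn_eq oU _ H) => x /dh[_ ->].
Qed.

(** * Zeros in a fixed box, over an arbitrary set of parameters *)

Section interval_box.
Context (S : set 'cV[R]_d) (c e : 'cV[R]_k) (lo hi : 'M[R]_k).
Hypothesis dF : forall w, D w -> differentiable F w.
Hypothesis boxD : forall x y, S x -> imx c e y -> D (z x y).
Hypothesis boxJ : forall x y, S x -> imx c e y ->
  imx lo hi (jac F (z x y) *m A2).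
Hypothesis boxU : forall A, imx lo hi A -> A \in unitmx.

Lemma box_mean_value x y y' : S x -> imx c e y -> imx c e y' ->
  exists2 M, imx lo hi M & F (z x y) - F (z x y') = M *m (y - y').
Proof.
move=> Sx Yy Yy'.
have zE (t : R) : z x y' + t *: (A2 *m (y - y')) = z x (y' + t *: (y - y')).
  by rewrite scalemxAr mulmxDr addrA.
have [t t01|M boxM] :=
    @interval_mean_value _ _ _ _ F A2 (z x y') (y - y') lo hi.
  have Yt : imx c e (y' + t *: (y - y')) by exact: imx_convex.
  by rewrite zE; split; [exact/dF/boxD|exact: boxJ].
by have := zE 1; rewrite !scale1r => ->; rewrite [y' + _]addrC subrK; exists M.
Qed.

Lemma box_zero_unique x y y' : S x -> imx c e y -> imx c e y' ->
  F (z x y) = 0 -> F (z x y') = 0 -> y = y'.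
Proof.
move=> Sx Yy Yy' y0 y'0; have [M boxM] := box_mean_value Sx Yy Yy'.
rewrite y0 y'0 subrr => /esym M0; apply/subr0_eq.
by rewrite -(mulKmx (boxU boxM) (y - y')) M0 mulmx0.
Qed.

Lemma box_zero_exists x y0 : S x -> imx c e y0 ->
  (forall M, imx lo hi M -> imx c e (y0 - invmx M *m F (z x y0))) ->
  exists2 y, imx c e y & F (z x y) = 0.
Proof.
move=> Sx Yy0; apply: (@interval_newton _ _ _ _ _ (fun y => F (z x y))) => //.
  move=> y Yy; apply: (@continuous_comp _ _ _ (fun y => z x y) F); last first.
    exact/differentiable_continuous/dF/boxD.
  apply: (@continuousD _ _ _ (fun=> p + A1 *m x)); first exact: cst_continuous.
  exact: continuous_mulmxl.
by move=> y y' Yy Yy'; exact: box_mean_value.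
Qed.

(** Expansiveness bounds the distance from [q x] to [q x'] by a multiple of the value of [F] at
    [z x (q x')], which tends to zero as [x] tends to [x']. Continuity is relative to [S], which may
    be a closed box. *)
Lemma box_zero_continuous q x' : S x' ->
  (forall x, S x -> imx c e (q x) /\ F (z x (q x)) = 0) ->
  forall eps, 0 < eps -> \forall x \near x', S x -> `|q x - q x'| < eps.
Proof.
move=> Sx' qP eps eps0.
have [C C0 expC] := unitmx_interval_expansive boxU.
have [Yq' Fq'] := qP _ Sx'.
have cz : {for x', continuous (fun x => F (z x (q x')))}.
  apply: (@continuous_comp _ _ _ (fun x => z x (q x')) F).
    exact: (@continuous_affine (fun=> q x') x' (@cst_continuous _ _ _ _)).
  exact/differentiable_continuous/dF/boxD.
have Fsmall : \forall x \near x', `|F (z x (q x'))| < eps / C.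
  have H := (@cvgrPdist_lt _ _ _ _ _ _ _).1 cz (eps / C) (divr_gt0 eps0 C0).
  near=> x; rewrite -normrN -sub0r -Fq'.
  by near: x; exact: H.
near=> x => Sx; have : `|F (z x (q x'))| < eps / C by near: x.
rewrite ltr_pdivlMr// mulrC => small.
have [Yq Fq] := qP _ Sx.
have [M boxM] := box_mean_value Sx Yq' Yq.
rewrite Fq subr0 => FM; rewrite distrC.
by apply: le_lt_trans (expC M _ boxM) _; rewrite -FM.
Unshelve. all: by end_near. Qed.

End interval_box.

(** Around a nondegenerate zero, [jac F *m A2] stays in a small interval matrix of invertible
    matrices, and the Newton inclusion holds on a small cube around [ys]. One pair [U], [h] serves
    all orders [n], as the class of infinite order requires; uniqueness in the cube later identifies
    [h] with a given solution. *)
Lemma implicit_function xs ys : open D -> Cn 1 D F -> D (z xs ys) ->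
  F (z xs ys) = 0 -> jac F (z xs ys) *m A2 \in unitmx ->
  exists (U : set 'cV[R]_d) (eps : R) (h : 'cV[R]_d -> 'cV[R]_k),
    [/\ open U, U xs, 0 < eps,
        forall x y, U x -> `|y - ys| <= eps -> F (z x y) = 0 -> y = h x &
        (forall x, U x -> D (z x (h x))) /\
        forall n, Cn n.+1 D F -> Cn n.+1 U h].
Proof.
move=> oD CF Dzs Fzs uB; set B := jac F (z xs ys) *m A2 in uB.
have [dF _] := CF.
have [r r0 rU] : exists2 r : R, 0 < r &
    forall A, `|A - B| < r -> A \in unitmx.
  exact/near_norm/open_nbhs_nbhs/(conj (@open_unitmx _ _)).
pose lo := B - const_mx (r / 2); pose hi := B + const_mx (r / 2).
have r20 : 0 <= r / 2 by rewrite ltW// divr_gt0.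
have boxU A : imx lo hi A -> A \in unitmx.
  move=> /(imx_ball _ _ r20) AB; apply: rU; apply: le_lt_trans AB _; lra.
have CJ : Cn 0 D (fun w => jac F w *m A2).
  by apply: Cn_mulmx => //; [exact: Cn_jac|exact: Cn_cst].
have [r1 r10 r1P] : exists2 r1 : R, 0 < r1 & forall w,
    `|w - z xs ys| < r1 -> D w /\ imx lo hi (jac F w *m A2).
  apply: near_norm; near=> w; split; first by near: w; exact: open_nbhs_nbhs.
  apply/(imx_ball _ _ r20); near: w.
  have H := @cvgr_distC_le _ _ _ _ _ (fun w => jac F w *m A2) _ (CJ _ Dzs).
  apply: H; by rewrite divr_gt0.
pose a := d%:R * `|A1|; pose b := k%:R * `|A2|.
have a0 : 0 <= a by rewrite mulr_ge0.
have b0 : 0 <= b by rewrite mulr_ge0.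
(* With both increments at most [eps], the point moves by at most [(a + b) * eps], which is strictly
   less than [r1]. *)
pose eps := r1 / (a + b + 1).
have eps0 : 0 < eps by rewrite divr_gt0// ltr_wpDl// addr_ge0.
have zr1 x y : `|x - xs| < eps -> `|y - ys| <= eps ->
    `|z x y - z xs ys| < r1.
  move=> xe ye; rewrite affineB (le_lt_trans (ler_normD _ _))//.
  have h1 : `|A1 *m (x - xs)| <= a * eps.
    by rewrite (le_trans (mx_norm_mulmx _ _))// ler_wpM2l// ltW.
  have h2 : `|A2 *m (y - ys)| <= b * eps.
    by rewrite (le_trans (mx_norm_mulmx _ _))// ler_wpM2l.
  have : (a + b + 1) * eps = r1.
    by rewrite mulrC divfK// gt_eqF// ltr_wpDl// addr_ge0.
  by lra.
pose c := ys - const_mx eps; pose e := ys + const_mx eps.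
have YP y : imx c e y <-> `|y - ys| <= eps by apply: imx_ball; exact: ltW.
have [C C0 expC] := unitmx_interval_expansive boxU.
have cz : {for xs, continuous (fun x => F (z x ys))}.
  apply: (@continuous_comp _ _ _ (fun x => z x ys) F).
    exact: (@continuous_affine (fun=> ys) xs (@cst_continuous _ _ _ _)).
  exact/differentiable_continuous/dF.
(* With [C] bounding the inverses, values below [eps / C] keep the Newton step from [ys] within
   [eps]. *)
have [r2 r20' r2P] : exists2 r2 : R, 0 < r2 & forall x, `|x - xs| < r2 ->
    `|F (z x ys)| < eps / C.
  apply: near_norm.
  have H := (@cvgrPdist_lt _ _ _ _ _ _ _).1 cz (eps / C) (divr_gt0 eps0 C0).
  near=> x; rewrite -normrN -sub0r -Fzs.
  by near: x; exact: H.
pose rho := Num.min eps r2.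
have rho0 : 0 < rho by rewrite lt_min eps0.
pose U := [set x | `|x - xs| < rho].
have Ueps x : U x -> `|x - xs| < eps by rewrite /U/= lt_min => /andP[].
have Ur2 x : U x -> `|x - xs| < r2 by rewrite /U/= lt_min => /andP[].
have oU : open U.
  rewrite (_ : U = ball xs rho); first exact: ball_open.
  by apply/seteqP; split=> x; rewrite /U/= -ball_normE/= distrC.
have UD x y : U x -> imx c e y -> D (z x y).
  by move=> Ux /YP Yy; exact: (r1P _ (zr1 _ _ (Ueps _ Ux) Yy)).1.
have UJ x y : U x -> imx c e y -> imx lo hi (jac F (z x y) *m A2).
  by move=> Ux /YP Yy; exact: (r1P _ (zr1 _ _ (Ueps _ Ux) Yy)).2.
have Yys : imx c e ys by apply/YP; rewrite subrr normr0 ltW.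
have ex_h x : exists y, U x -> imx c e y /\ F (z x y) = 0.
  have [Ux|nUx] := pselect (U x); last by exists 0.
  have [|y Yy Fy] := box_zero_exists dF UD UJ boxU Ux Yys.
    move=> M boxM; apply/YP; rewrite addrAC subrr sub0r normrN.
    apply: le_trans (expC M _ boxM) _; rewrite mulKVmx ?boxU// mulrC.
    by rewrite -ler_pdivlMr// ltW// r2P// Ur2.
  by exists y.
have [h hP] := choice ex_h.
exists U, eps, h; split=> //.
- by rewrite /U/= subrr normr0.
- move=> x y Ux /YP Yy Fy; have [Yh Fh] := hP _ Ux.
  exact: (box_zero_unique dF UD UJ boxU Ux).
split=> [x Ux|n CnF]; first by apply: UD => //; have [] := hP _ Ux.
apply: (Cn_zero oU oD CnF) => x Ux.
- apply/(@cvgrPdist_lt _ _ _ (nbhs x)) => eta eta0.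
  have H := box_zero_continuous dF UD UJ boxU Ux hP eta0.
  have NU := open_nbhs_nbhs (conj oU Ux).
  near=> x'; rewrite distrC.
  have Ux' : U x' by near: x'.
  by move: Ux'; near: x'.
- have [Yh Fh] := hP _ Ux; split; [exact: UD|exact: Fh|].
  exact/boxU/UJ.
Unshelve. all: by end_near. Qed.

End affine_zero.
(** * Stable sets, charts and tangent spaces *)

Lemma open_unit_ball (R : realType) (n : nat) : open (@unit_ball R n).
Proof.
have cs : continuous (fun x : 'cV[R]_n => \sum_(i < n) x i 0 ^+ 2).
  move=> x; have CE i : Cn 0 setT (fun x : 'cV[R]_n => x i 0).
    apply: (@Cn_entry _ _ 0 setT _ _ idfun); first exact: openT.
    exact: (@Cn_linear _ _ _ 0 setT idfun (fun x => @cvg_id _ _)).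
  have H := Cn_sum (index_enum _) openT (fun i (_ : xpredT i) =>
    Cn_mul openT (CE i) (CE i)).
  exact: (H x).
rewrite (_ : unit_ball n = (fun x : 'cV[R]_n => \sum_(i < n) x i 0 ^+ 2) @^-1`
  [set t | t < 1])//.
by apply: open_comp => [x _|]; [exact: cs|exact: open_lt].
Qed.

Lemma continuous_usubmx_cv (R : realType) (m n : nat) :
  continuous (usubmx : 'cV[R]_(m + n) -> 'cV[R]_m).
Proof.
move=> x; apply: continuous_mx => i j.
rewrite (_ : (fun z => _) = fun z : 'cV[R]_(m + n) => z (lshift n i) j).
  exact: coord_continuous.
by apply/funext => z; rewrite mxE.
Qed.

Lemma continuous_dsubmx_cv (R : realType) (m n : nat) :
  continuous (dsubmx : 'cV[R]_(m + n) -> 'cV[R]_n).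
Proof.
move=> x; apply: continuous_mx => i j.
rewrite (_ : (fun z => _) = fun z : 'cV[R]_(m + n) => z (rshift m i) j).
  exact: coord_continuous.
by apply/funext => z; rewrite mxE.
Qed.

Lemma open_ball_prod (R : realType) (u s : nat) : open (@ball_prod R u s).
Proof.
rewrite (_ : ball_prod u s =
  usubmx @^-1` (@unit_ball R u) `&` dsubmx @^-1` (@unit_ball R s))//.
apply: openI; apply: open_comp => [x _|]; do ?exact: open_unit_ball.
  exact: continuous_usubmx_cv.
exact: continuous_dsubmx_cv.
Qed.

Lemma Cn_iter (R : realType) (k n l : nat) (f : 'cV[R]_k -> 'cV[R]_k) :
  Cn n setT f -> Cn n setT (iter l f).
Proof.
move=> Cf; elim: l => [|l IHl].
  exact: (@Cn_linear _ _ _ n setT idfun (fun x => @cvg_id _ _)).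
exact: (Cn_comp openT openT (fun=> fun=> I) IHl Cf).
Qed.

Lemma iter_cancel (T : Type) (g h : T -> T) (l : nat) :
  cancel g h -> cancel (iter l g) (iter l h).
Proof.
by move=> gh; elim: l => [//|l IHl] x; rewrite iterSr /= gh IHl.
Qed.

Lemma stable_set_iter (R : realType) (k l : nat)
    (g h : 'cV[R]_k -> 'cV[R]_k) (p w : 'cV[R]_k) :
  cancel g h -> stable_set h p w -> stable_set h p (iter l g w).
Proof.
move=> gh hw; rewrite /stable_set/=.
rewrite -(cvg_shiftn l) (_ : [sequence _]_n = fun n => iter n h w)//.
by apply/funext => n /=; rewrite iterD iter_cancel.
Qed.

(** Continuity of [iter l g] for the leaf topology. The [h]-orbit of [iter l g w'] first runs
    through the points [iter j g w'] with [j <= l], finitely many and controlled by ordinary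
    continuity at [w], and then follows the orbit of [w']. *)
Lemma leaf_nbhs_iter (R : realType) (k l : nat)
    (g h : 'cV[R]_k -> 'cV[R]_k) (p w : 'cV[R]_k) (V : set 'cV[R]_k) :
  cancel g h -> continuous g -> leaf_nbhs h p (iter l g w) V ->
  leaf_nbhs h p w (iter l g @^-1` V).
Proof.
move=> gh cg [e e0 eV].
have cgj j : continuous (iter j g).
  elim: j => [|j IHj] x; first exact: cvg_id.
  by apply: (@continuous_comp _ _ _ (iter j g) g); [exact: IHj|exact: cg].
have near_j j : \forall w' \near w, `|iter j g w' - iter j g w| < e.
  have H := (@cvgrPdist_lt _ _ _ _ _ _ _).1 (cgj j w) e e0.
  by near=> w'; rewrite distrC; near: w'; exact: H.
have [e1 e10 e1P] : exists2 e1 : R, 0 < e1 & forall w', `|w' - w| < e1 ->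
    forall j : 'I_l.+1, `|iter j g w' - iter j g w| < e.
  apply: near_norm; near=> w'; near: w'.
  by apply: filter_forall => j; exact: near_j.
exists (Num.min e e1); first by rewrite lt_min e0.
move=> w' hw' ww'; apply: eV => [|n]; first exact: stable_set_iter.
have [nl|ln] := leqP n l.
  rewrite -(subnKC nl) !iterD !(iter_cancel _ gh).
  have := ww' 0%N; rewrite /= lt_min => /andP[_ /e1P].
  by move=> /(_ (Ordinal (leq_ltn_trans (leq_subr n l) (ltnSn l)))).
rewrite -(subnK (ltnW ln)) !iterD !(iter_cancel _ gh).
by have := ww' (n - l)%N; rewrite lt_min => /andP[].
Unshelve. all: by end_near. Qed.

(** The curve is the image of the line through [x] in direction [v]. It is continuous for the leaf
    topology by the last clause of [is_chart] and [leaf_nbhs_iter]. *)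
Lemma tangent_space_chart (R : realType) (k l n : nat) (r : option nat)
    (g h : 'cV[R]_k -> 'cV[R]_k) (p : 'cV[R]_k)
    (P : 'cV[R]_n -> 'cV[R]_k) (x v : 'cV[R]_n) :
  cancel g h -> continuous g -> is_chart r h p P -> unit_ball n x ->
  differentiable (iter l g \o P) x ->
  tangent_space h p (iter l g (P x)) ('d (iter l g \o P) x v).
Proof.
move=> gh cg [_ _ _ _ leafP] Bx dP.
exists (fun t => (iter l g \o P) (x + t *: v)).
have x0 : x + 0 *: v = x by rewrite scale0r addr0.
split; first by rewrite /= x0.
  move=> V /(leaf_nbhs_iter gh cg) /(leafP _ Bx) NV.
  have cl : {for 0 : R, continuous (fun t : R => x + t *: v)}.
    apply: (@continuousD _ _ _ (fun=> x)).
      exact: cst_continuous.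
    exact: scalel_continuous.
  have NV0 : nbhs (x + 0 *: v) (P @^-1` (iter l g @^-1` V)) by rewrite x0.
  exact: (cl _ NV0).
have := @is_derive_line _ _ _ (iter l g \o P) x v 0.
by rewrite x0; apply.
Qed.

(* smooth_order r n states that n + 1 <= r. *)
Definition smooth_order (r : option nat) (n : nat) : bool :=
  if r is Some m then (n < m)%N else true.

(** Treats finite and infinite smoothness alike, through the positive orders. For [r = Some 0] the
    right-hand side would be vacuous. *)
Lemma CrP (R : realType) (V W : normedModType R) (r : option nat) (U : set V)
    (F : V -> W) : r <> Some 0%N ->
  Cr r U F <-> forall n, smooth_order r n -> Cn n.+1 U F.
Proof.
case: r => [[//|m]|] _; split=> CF.
- by move=> n nm; exact: (Cn_le nm CF).
- by apply: CF; exact: ltnSn.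
- by move=> n _; exact: CF.
- by case=> [|n]; [apply/CnW/CF|exact: CF].
Qed.

(** * The difference map of the two charts and transversality at its zeros *)

Section Fmap_theory.
Context {R : realType} {k u s : nat} (f finv : 'cV[R]_k -> 'cV[R]_k)
  (P1 : 'cV[R]_u -> 'cV[R]_k) (P2 : 'cV[R]_s -> 'cV[R]_k) (l1 l2 : nat).

Local Notation F := (Fmap f finv P1 P2 l1 l2).

Lemma Cn_chart_iter n m l (g : 'cV[R]_k -> 'cV[R]_k)
    (P : 'cV[R]_m -> 'cV[R]_k) :
  Cn n setT g -> Cn n (unit_ball m) P -> Cn n (unit_ball m) (iter l g \o P).
Proof.
move=> Cg CP; have Cl := Cn_iter l Cg.
exact: (Cn_comp (@open_unit_ball _ _) openT (fun=> fun=> I) CP Cl).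
Qed.

Lemma Cn_usubmx n : Cn n (ball_prod u s) (usubmx : 'cV[R]_(u + s) -> 'cV[R]_u).
Proof. exact: Cn_linear (@continuous_usubmx_cv _ _ _). Qed.

Lemma Cn_dsubmx n : Cn n (ball_prod u s) (dsubmx : 'cV[R]_(u + s) -> 'cV[R]_s).
Proof. exact: Cn_linear (@continuous_dsubmx_cv _ _ _). Qed.

Lemma Cn_Fmap n : Cn n setT f -> Cn n setT finv ->
  Cn n (unit_ball u) P1 -> Cn n (unit_ball s) P2 -> Cn n (ball_prod u s) F.
Proof.
move=> Cf Cfinv C1 C2; have oB := @open_ball_prod R u s.
apply: Cn_add => //; last apply: Cn_opp => //.
- exact: (Cn_comp oB (@open_unit_ball _ _) (fun z Bz => Bz.1) (Cn_usubmx n)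
    (Cn_chart_iter l1 Cf C1)).
- exact: (Cn_comp oB (@open_unit_ball _ _) (fun z Bz => Bz.2) (Cn_dsubmx n)
    (Cn_chart_iter l2 Cfinv C2)).
Qed.

Lemma diff_Fmap z w : differentiable (iter l1 f \o P1) (usubmx z) ->
  differentiable (iter l2 finv \o P2) (dsubmx z) ->
  'd F z w = 'd (iter l1 f \o P1) (usubmx z) (usubmx w) -
             'd (iter l2 finv \o P2) (dsubmx z) (dsubmx w).
Proof.
move=> d1 d2.
have du : differentiable (usubmx : 'cV[R]_(u + s) -> 'cV[R]_u) z.
  exact: linear_differentiable (@continuous_usubmx_cv _ _ _).
have dd : differentiable (dsubmx : 'cV[R]_(u + s) -> 'cV[R]_s) z.
  exact: linear_differentiable (@continuous_dsubmx_cv _ _ _).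
have E1 := diff_comp du d1; have E2 := diff_comp dd d2.
have E := diffB (differentiable_comp du d1) (differentiable_comp dd d2).
have Lu := diff_lin z (@continuous_usubmx_cv R u s).
have Ld := diff_lin z (@continuous_dsubmx_cv R u s).
transitivity ('d ((iter l1 f \o P1) \o usubmx) z w -
              'd ((iter l2 finv \o P2) \o dsubmx) z w).
  have E' := congr1 (fun h : 'cV[R]_(u + s) -> 'cV[R]_k => h w) E.
  exact: E'.
congr (_ - _).
  apply: etrans (congr1 (fun h : 'cV[R]_(u + s) -> 'cV[R]_k => h w) E1) _.
  have Lu' := congr1 (fun h : 'cV[R]_(u + s) -> 'cV[R]_u =>
    'd (iter l1 f \o P1) (usubmx z) (h w)) Lu.
  exact: Lu'.
apply: etrans (congr1 (fun h : 'cV[R]_(u + s) -> 'cV[R]_k => h w) E2) _.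
have Ld' := congr1 (fun h : 'cV[R]_(u + s) -> 'cV[R]_s =>
  'd (iter l2 finv \o P2) (dsubmx z) (h w)) Ld.
exact: Ld'.
Qed.

Lemma transversal_at_zero (r : option nat) (p1 p2 : 'cV[R]_k) z :
  r <> Some 0%N -> is_diffeo r f finv ->
  is_chart r finv p1 P1 -> is_chart r f p2 P2 ->
  ball_prod u s z -> F z = 0 -> (forall v, exists w, 'd F z w = v) ->
  transversal_at f finv p1 p2 (iter l1 f (P1 (usubmx z))).
Proof.
move=> r0 [ff fi Cf Cfinv] ch1 ch2 [B1 B2] Fz surjF.
have order0 : smooth_order r 0 by case: (r) r0 => [[]|].
have {}Cf := (CrP _ _ r0).1 Cf 0%N order0.
have {}Cfinv := (CrP _ _ r0).1 Cfinv 0%N order0.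
have d1 : differentiable (iter l1 f \o P1) (usubmx z).
  have [/(CrP _ _ r0)/(_ 0%N order0) C1 _ _ _ _] := ch1.
  exact: (Cn_chart_iter l1 Cf C1).1.
have d2 : differentiable (iter l2 finv \o P2) (dsubmx z).
  have [/(CrP _ _ r0)/(_ 0%N order0) C2 _ _ _ _] := ch2.
  exact: (Cn_chart_iter l2 Cfinv C2).1.
have cf : continuous f by move=> x; exact: (CnW Cf x I).
have cfinv : continuous finv by move=> x; exact: (CnW Cfinv x I).
have E : iter l1 f (P1 (usubmx z)) = iter l2 finv (P2 (dsubmx z)).
  exact/subr0_eq.
split.
- by apply: stable_set_iter => //; have [_ _ _ + _] := ch1; exact.
- by rewrite E; apply: stable_set_iter => //; have [_ _ _ + _] := ch2; exact.
apply/seteqP; split=> // v _; have [w <-] := surjF v.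
(* The minus sign moves into the argument, so that the second summand is again an image under a
   differential. *)
rewrite diff_Fmap// -linearN.
exists ('d (iter l1 f \o P1) (usubmx z) (usubmx w)).
  exact: (tangent_space_chart _ ff cf ch1 B1 d1).
exists ('d (iter l2 finv \o P2) (dsubmx z) (- dsubmx w)) => //.
by rewrite E; exact: (tangent_space_chart _ fi cfinv ch2 B2 d2).
Qed.

End Fmap_theory.

(** * Zero graph, transversality along it, and smoothness of the intersection *)

Theorem theorem4p12 (R : realType) (k : nat) (r : option nat)
    (f finv : 'cV[R]_k -> 'cV[R]_k) (p1 p2 : 'cV[R]_k) (u1 s2 : nat)
    (P1 : 'cV[R]_u1 -> 'cV[R]_k) (P2 : 'cV[R]_s2 -> 'cV[R]_k) (l1 l2 : nat)
    (pstar : 'cV[R]_(u1 + s2))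
    (A1 : 'M[R]_(u1 + s2, u1 + s2 - k)) (A2 : 'M[R]_(u1 + s2, k))
    (a b x0 : 'cV[R]_(u1 + s2 - k)) (c d y0 : 'cV[R]_k)
    (* interval enclosures: [DF_{X,Y} A2], [DF_{X,y0} A1], [X - x0],
       [DF_{X,y0} A1][X - x0] and [DF_{X,Y} A2]^-1 (...) *)
    (lo2 hi2 : 'M[R]_(k, k)) (lo1 hi1 : 'M[R]_(k, u1 + s2 - k))
    (loV hiV : 'cV[R]_(u1 + s2 - k)) (loW hiW loZ hiZ : 'cV[R]_k) :
  let F := Fmap f finv P1 P2 l1 l2 in
  let X := imx a b in
  let Y := imx c d in
  let DFXY := [set jac F z | z in affine_image pstar A1 A2 X Y] in
  let DFXy0 := [set jac F z | z in affine_image pstar A1 A2 X [set y0]] in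
  r <> Some 0%N ->
  is_diffeo r f finv ->
  hyperbolic_fixpoint f p1 ->
  hyperbolic_fixpoint f p2 ->
  stable_set_dim r finv p1 u1 ->
  stable_set_dim r f p2 s2 ->
  (k < u1 + s2)%N ->
  is_chart r finv p1 P1 ->
  is_chart r f p2 P2 ->
  ball_prod u1 s2 pstar ->
  F pstar = 0 ->
  X x0 ->
  Y y0 ->
  affine_image pstar A1 A2 X Y `<=` ball_prod u1 s2 ->
  [set M *m A2 | M in DFXY] `<=` imx lo2 hi2 ->
  [set M *m A1 | M in DFXy0] `<=` imx lo1 hi1 ->
  [set x - x0 | x in X] `<=` imx loV hiV ->
  [set A *m v | A in imx lo1 hi1 & v in imx loV hiV] `<=` imx loW hiW ->
  (forall A, imx lo2 hi2 A -> A \in unitmx) ->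
  [set invmx A *m v | A in imx lo2 hi2 &
     v in [set F (pstar + A1 *m x0 + A2 *m y0) + w | w in imx loW hiW]]
    `<=` imx loZ hiZ ->
  [set y0 - z | z in imx loZ hiZ] `<=` Y ->
  exists q : 'cV[R]_(u1 + s2 - k) -> 'cV[R]_k,
    let p := fun x =>
      iter l1 f (P1 (usubmx (pstar + A1 *m x + A2 *m q x))) in
    [/\ zero_graph F pstar A1 A2 X Y q,
        forall q', zero_graph F pstar A1 A2 X Y q' -> {in X, q' =1 q},
        forall x, X x -> transversal_at f finv p1 p2 (p x) &
        Cr_within r X p].
Proof.
move=> F X Y DFXY DFXy0 r0 diffeo _ _ _ _ _ ch1 ch2 _ _ Xx0 Yy0 XYB.
move=> enc2 enc1 encV encW uA encZ newtonY.
pose z x y := pstar + A1 *m x + A2 *m y.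
have oB := @open_ball_prod R u1 s2.
have XYD x y : X x -> Y y -> ball_prod u1 s2 (z x y).
  by move=> Xx Yy; apply: XYB; exists x => //; exists y.
have [ff fi Cf Cfi] := diffeo.
have [C1 _ _ _ _] := ch1; have [C2 _ _ _ _] := ch2.
have CF n : smooth_order r n -> Cn n.+1 (ball_prod u1 s2) F.
  by move=> rn; apply: Cn_Fmap; exact: (CrP _ _ r0).1.
have order0 : smooth_order r 0 by case: (r) r0 => [[]|].
have dF w : ball_prod u1 s2 w -> differentiable F w by exact: (CF 0%N order0).1.
have boxJ x y : X x -> Y y -> imx lo2 hi2 (jac F (z x y) *m A2).
  move=> Xx Yy; apply: enc2; exists (jac F (z x y)) => //.
  by exists (z x y) => //; exists x => //; exists y.
have ex_q x : exists y, X x -> Y y /\ F (z x y) = 0.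
  have [Xx|nXx] := pselect (X x); last by exists 0.
  have zt (t : R) : z x0 y0 + t *: (A1 *m (x - x0)) = z (x0 + t *: (x - x0)) y0.
    by rewrite /z scalemxAr mulmxDr addrA [RHS]addrAC.
  (* The mean value theorem along the segment from [x0] to [x], with [y0] fixed, puts [F (z x y0)]
     in the set whose Newton images are enclosed by [encZ]. *)
  have [t t01|M boxM] :=
      @interval_mean_value _ _ _ _ F A1 (z x0 y0) (x - x0) lo1 hi1.
    have Xt : X (x0 + t *: (x - x0)) by exact: imx_convex.
    rewrite zt; split; first exact/dF/XYD.
    apply: enc1; exists (jac F (z (x0 + t *: (x - x0)) y0)) => //.
    exists (z (x0 + t *: (x - x0)) y0) => //.
    by exists (x0 + t *: (x - x0)) => //; exists y0.
  have := zt 1; rewrite !scale1r => ->; rewrite [x0 + _]addrC subrK => FM.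
  have [|y Yy Fy] := box_zero_exists dF XYD boxJ uA Xx Yy0; last by exists y.
  move=> N boxN; apply: newtonY; exists (invmx N *m F (z x y0)) => //.
  apply: encZ; exists N => //; exists (F (z x y0)) => //.
  exists (M *m (x - x0)); last by rewrite -FM addrC subrK.
  apply: encW; exists M => //; exists (x - x0) => //.
  by apply: encV; exists x.
have [q qP] := choice ex_q.
exists q; split.
- exact: qP.
- move=> q' q'P x /set_mem Xx.
  have [Yq Fq] := qP x Xx; have [Yq' Fq'] := q'P x Xx.
  exact: (box_zero_unique dF XYD boxJ uA Xx).
- move=> x Xx; have [Yq Fq] := qP x Xx.
  apply: (transversal_at_zero r0 diffeo ch1 ch2 (XYD _ _ Xx Yq) Fq) => v.
  (* [A2] followed by [jac F] is invertible, which gives a right inverse of the differential. *)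
  exists (A2 *m (invmx (jac F (z x (q x)) *m A2) *m v)).
  by rewrite -jac_mulmx mulmxA mulKVmx// uA//; exact: boxJ.
move=> x Xx; have [Yq Fq] := qP x Xx.
have [U [eps [h [oU Ux eps0 h_unique [UB Ch]]]]] :=
  implicit_function oB (CF 0%N order0) (XYD _ _ Xx Yq) Fq
    (uA _ (boxJ _ _ Xx Yq)).
have q_near := box_zero_continuous dF XYD boxJ uA Xx qP eps0.
have [rho rho0 rhoP] := near_norm q_near.
(* On [X] within this ball, [q] stays within [eps] of [q x], so uniqueness makes it agree with [h];
   replacing [q] by [h] gives the smooth extension of [p]. *)
exists (U `&` ball x rho).
exists (fun x => iter l1 f (P1 (usubmx (z x (h x))))).
split.
- by apply: openI => //; exact: ball_open.
- by split=> //; exact: ballxx.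
- apply/(CrP _ _ r0) => n rn; apply: (@Cn_sub _ _ _ _ U) => [y []//|].
  have C1n := (CrP _ _ r0).1 C1 n rn; have Cfn := (CrP _ _ r0).1 Cf n rn.
  have Czn := Cn_affine pstar A1 A2 oU (Ch n (CF n rn)).
  have Cun := Cn_comp oU oB UB Czn (Cn_usubmx n.+1).
  exact: (Cn_comp oU (@open_unit_ball _ _) (fun y Uy => (UB y Uy).1) Cun
    (Cn_chart_iter l1 Cfn C1n)).
move=> y Xy [Uy]; rewrite -ball_normE/= distrC => yrho.
have [Yqy Fqy] := qP y Xy.
by rewrite -(h_unique y (q y) Uy (ltW (rhoP y yrho Xy)) Fqy).
Qed.
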